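(* Let $n,k\geq 2$ be integers. Let $P\in \mathbb{R}[X_1,\dots,X_n]$ be a polynomial of degree $k$ whose leading form (homogeneous part of degree $k$) is \[ P_k= Q_k+X_1Q_{k-1}+X_1^dQ_{k-d}+X_1^{d+1}Q_{k-(d+1)}+\cdots +X_1^kQ_0, \] where $2\leq d \leq k$ and $Q_{k-i}\in \mathbb{R}[X_2,\dots,X_n]$ is a form of degree $k-i$ for all $i\in\{0,1,d,d+1,\dots,k\}$. Assume $Q_{k-1}$ is not identically zero. Define $s_d=\frac{d-1}{2d}$ and $s_\infty=\frac12$. Let $s\in\mathbb{R}$ and suppose there exists a constant $C_s$ such that \[ \Big\|\sup_{0<t<1}|T_t^Pf|\Big\|_{L^1(B_n(0,1))} \leq C_s \|f\|_{H^s(\mathbb{R}^n)}\qquad \text{for all } f\in H^s(\mathbb{R}^n). \] Then $s\geq s_\infty$ if $Q_{k-i}$ is identically zero for all $d\leq i \leq k$, and otherwise $s\geq s_d$.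
   Context: A form of degree $e$ is a homogeneous polynomial of degree $e$; the zero polynomial is allowed. The Fourier transform is $\hat f(\xi)=\int_{\mathbb{R}^n} f(x)e^{-ix\cdot\xi}\,dx$. For a real polynomial $P$ in $n$ variables, define \[ T_t^{P}f(x) = \frac{1}{(2\pi)^n} \int_{\mathbb{R}^n} \hat{f}(\xi) e^{i(x\cdot \xi + P(\xi)t)}\,d\xi , \] initially for $f$ of Schwartz class on $\mathbb{R}^n$ (and extended to $H^s$ as the Fourier multiplier $e^{iP(\xi)t}$). The Sobolev space $H^s(\mathbb{R}^n)$ consists of all tempered distributions $f$ with finite norm given by $\|f\|_{H^s(\mathbb{R}^n)}^2=(2\pi)^{-n}\int_{\mathbb{R}^n}(1+|\xi|^2)^s|\hat f(\xi)|^2\,d\xi$. $B_n(0,1)$ is the unit ball in $\mathbb{R}^n$ centered at the origin. *)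

(* Defs.v *)
From HB Require Import structures.
From mathcomp Require Import all_boot all_order all_algebra.
From mathcomp Require Import complex.
From mathcomp Require Import all_classical all_reals all_analysis.
From mathcomp Require Import measurable_realfun.
From mathcomp Require Import (canonicals, coercions) mpoly.

Set Implicit Arguments.
Unset Strict Implicit.
Unset Printing Implicit Defensive.

Import Order.TTheory GRing.Theory Num.Theory.
Import numFieldNormedType.Exports.

Local Open Scope classical_set_scope.
Local Open Scope ring_scope.

(* A full import of mpoly.v would clash with the notations of
   mathcomp-analysis. *)
Notation "{ 'mpoly' T [ n ] }" := (mpoly.mpoly n T)
  (at level 0, T, n at level 2, format "{ 'mpoly'  T [ n ] }") : type_scope.

Section RowVectorMeasurable.
Variables (R : realType) (n : nat).

Let coords (i : 'I_n) (x : 'rV[R]_n) : measurableTypeR R := x 0 i.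

Let rV_set0 : g_sigma_preimage coords set0.
Proof. exact: sigma_algebra0. Qed.

Let rV_setC A : g_sigma_preimage coords A -> g_sigma_preimage coords (~` A).
Proof. exact: sigma_algebraC. Qed.

Let rV_bigcup (F : (set 'rV[R]_n)^nat) :
  (forall i, g_sigma_preimage coords (F i)) ->
  g_sigma_preimage coords (\bigcup_i (F i)).
Proof. exact: sigma_algebra_bigcup. Qed.

(* The Borel sigma-algebra of R^n, generated by the coordinates (as the library
   does for n.-tuple). *)
HB.instance Definition _ := @isMeasurable.Build
  (measure_tuple_display default_measure_display)
  'rV[R]_n (g_sigma_preimage coords) rV_set0 rV_setC rV_bigcup.

Lemma measurable_coord (i : 'I_n) :
  measurable_fun [set: 'rV[R]_n] (fun x => x 0 i : measurableTypeR R).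
Proof.
move=> _ Y mY; rewrite setTI; apply: sub_sigma_algebra => /=.
rewrite -bigcup_seq/=; exists i => /=; first by rewrite mem_index_enum.
by exists Y => //; rewrite setTI.
Qed.

Lemma measurable_fun_coords d (T : measurableType d) (f : T -> 'rV[R]_n) :
  (forall i, measurable_fun [set: T] (fun t => f t 0 i : measurableTypeR R)) ->
  measurable_fun [set: T] f.
Proof.
move=> mf.
have pre : g_sigma_preimage (fun i => coords i \o f) `<=` measurable.
  apply: smallest_sub; first exact: sigma_algebra_measurable.
  move=> A; rewrite -bigcup_seq => -[i _] [B mB <-].
  exact: (mf i).
move=> _ A mA; apply: pre; rewrite g_sigma_preimage_comp.
by exists A.
Qed.

End RowVectorMeasurable.

Section Lebesgue.
Variable R : realType.

Definition rVcons n (p : measurableTypeR R * 'rV[R]_n) : 'rV[R]_n.+1 :=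
  row_mx (p.1%:M : 'M[R]_1) p.2.

Definition rVuncons n (x : 'rV[R]_n.+1) : measurableTypeR R * 'rV[R]_n :=
  (x 0 ord0, \row_j x 0 (lift ord0 j)).

Lemma rVcons0 n p : @rVcons n p 0 ord0 = p.1.
Proof.
rewrite /rVcons (_ : ord0 = lshift n (ord0 : 'I_1)); last exact: val_inj.
by rewrite [LHS](row_mxEl _ p.2) !mxE eqxx mulr1n.
Qed.

Lemma rVconsS n p j : @rVcons n p 0 (lift ord0 j) = p.2 0 j.
Proof.
rewrite /rVcons (_ : lift ord0 j = rshift 1 j); last exact: val_inj.
exact: row_mxEr.
Qed.

Lemma rVconsK n : cancel (@rVcons n) (@rVuncons n).
Proof.
move=> [a x]; rewrite /rVuncons rVcons0; congr pair.
by apply/rowP => j; rewrite mxE rVconsS.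
Qed.

Lemma measurable_rVcons n : measurable_fun setT (@rVcons n).
Proof.
apply: measurable_fun_coords => i.
case: (unliftP ord0 i) => [j ->|->].
  under eq_fun do rewrite rVconsS.
  apply: (@measurableT_comp _ _ _ _ _ _ (fun x : 'rV[R]_n => x 0 j)) => //.
  exact: measurable_coord.
under eq_fun do rewrite rVcons0.
exact: measurable_fst.
Qed.

Lemma measurable_rVuncons n : measurable_fun setT (@rVuncons n).
Proof.
apply/measurable_fun_pairP; split; first exact: measurable_coord.
apply: measurable_fun_coords => i; under eq_fun do rewrite mxE.
exact: measurable_coord.
Qed.

Section step.
Variables (n : nat) (mu : {sigma_finite_measure set 'rV[R]_n -> \bar R}).

Definition lebesgue_step : set 'rV[R]_n.+1 -> \bar R :=
  pushforward (@lebesgue_measure R \x mu)%E (@rVcons n).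

Let mcons := @measurable_rVcons n.

Let step0 : lebesgue_step set0 = 0%E.
Proof. by rewrite /lebesgue_step /pushforward preimage_set0 measure0. Qed.

Let step_ge0 A : (0 <= lebesgue_step A)%E.
Proof. exact: measure_ge0. Qed.

Let step_sigma_additive : semi_sigma_additive lebesgue_step.
Proof.
exact: (@measure_semi_sigma_additive _ _ _
  (measure_function_pushforward__canonical__measure_function_Measure
    (@lebesgue_measure R \x mu)%E mcons)).
Qed.

HB.instance Definition _ :=
  isMeasure.Build _ _ _ lebesgue_step step0 step_ge0 step_sigma_additive.

Let step_sigma_finite : sigma_finite setT lebesgue_step.
Proof.
have /sigma_finiteP[F [TF ndF Foo]] := sigma_finiteT (@lebesgue_measure R).
have /sigma_finiteP[G [TG ndG Goo]] := sigma_finiteT mu.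
exists (fun k => @rVuncons n @^-1` (F k `*` G k)).
  apply/seteqP; split=> // x _.
  have [i _ Fi] : (\bigcup_i F i) (rVuncons x).1 by rewrite -TF.
  have [j _ Gj] : (\bigcup_i G i) (rVuncons x).2 by rewrite -TG.
  exists (maxn i j) => //; split.
    by move: Fi; exact/subsetPset/ndF/leq_maxl.
  by move: Gj; exact/subsetPset/ndG/leq_maxr.
move=> k; have [mF Fk] := Foo k; have [mG Gk] := Goo k; split.
  rewrite -[X in measurable X]setTI; apply: measurable_rVuncons => //.
  exact: measurableX.
rewrite /lebesgue_step /pushforward (_ : _ @^-1` _ = F k `*` G k).
  by rewrite product_measure1E// lte_mul_pinfty// ge0_fin_numE.
by rewrite -comp_preimage (_ : _ \o _ = id) ?preimage_id//; apply/funext/rVconsK.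
Qed.

HB.instance Definition _ :=
  Measure_isSigmaFinite.Build _ _ _ lebesgue_step step_sigma_finite.

End step.

Fixpoint lebesgue_rV (n : nat) :
    {sigma_finite_measure set 'rV[R]_n -> \bar R} :=
  if n is n'.+1 then lebesgue_step (lebesgue_rV n') else \d_(0 : 'rV[R]_0).

Lemma lebesgue_rV_box n (A : 'I_n -> set (measurableTypeR R)) :
  (forall i, measurable (A i)) ->
  lebesgue_rV n [set x | forall i, A i (x 0 i)] =
  (\prod_(i < n) lebesgue_measure (A i))%E.
Proof.
elim: n A => [|n IH] A mA.
  rewrite big_ord0 /= diracE mem_set//; by case.
pose B := [set x : 'rV[R]_n | forall i, A (lift ord0 i) (x 0 i)].
have mB : measurable B.
  rewrite (_ : B =
      \bigcap_(i in [set: 'I_n]) ((fun x => x 0 i) @^-1` A (lift ord0 i))).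
    apply: fin_bigcap_measurable; [exact: finite_finset|].
    move=> i _; rewrite -[X in measurable X]setTI.
    exact: (measurable_coord i).
  by apply/seteqP; split=> x /= Bx i => [_|]; exact: Bx.
transitivity ((@lebesgue_measure R \x lebesgue_rV n) (A ord0 `*` B))%E.
  rewrite /= /lebesgue_step /pushforward; congr (_ _).
  apply/seteqP; split=> -[a x] /=.
    move=> Aax; split => [|i].
      by have := Aax ord0; rewrite rVcons0.
    by have := Aax (lift ord0 i); rewrite rVconsS.
  move=> [Aa Ax] i; case: (unliftP ord0 i) => [j ->|->].
    by rewrite rVconsS; exact: Ax.
  by rewrite rVcons0.
by rewrite product_measure1E// big_ord_recl (IH (fun i => A (lift ord0 i))).
Qed.

End Lebesgue.

Section Analysis.
Variables (R : realType) (n : nat).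

Local Notation Rn := 'rV[R]_n.
Local Notation C := R[i].
Local Notation mu := (lebesgue_rV R n).

Definition dot (x y : Rn) : R := \sum_(i < n) x 0 i * y 0 i.

(* |x|^2 for the Euclidean norm; the library's norm on 'rV[R]_n is the sup
   norm. *)
Definition sqnorm (x : Rn) : R := dot x x.

Definition unit_ball : set Rn := [set x | sqnorm x < 1].

Definition cis (theta : R) : C := (cos theta +i* sin theta)%C.

Definition cabs (z : C) : R := Normc.normc z.

Definition cmeasurable (f : Rn -> C) : Prop :=
  measurable_fun setT (fun x => complex.Re (f x)) /\
  measurable_fun setT (fun x => complex.Im (f x)).

Definition cintegrable (f : Rn -> C) : Prop :=
  mu.-integrable setT (fun x => (complex.Re (f x))%:E) /\
  mu.-integrable setT (fun x => (complex.Im (f x))%:E).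

Definition cintegral (f : Rn -> C) : C :=
  ((\int[mu]_x complex.Re (f x)) +i* (\int[mu]_x complex.Im (f x)))%C.

(* For a = [:: i1; ...; im] this is the partial derivative d_i1 ... d_im f. *)
Fixpoint partial (a : seq 'I_n) (f : Rn -> R) : Rn -> R :=
  if a is i :: a' then fun x => 'D_(delta_mx 0 i) (partial a' f) x else f.

Definition cpartial (a : seq 'I_n) (f : Rn -> C) (x : Rn) : C :=
  (partial a (fun y => complex.Re (f y)) x
     +i* partial a (fun y => complex.Im (f y)) x)%C.

Definition smooth (f : Rn -> R) : Prop :=
  forall (a : seq 'I_n) (x : Rn), differentiable (partial a f) x.

Definition csmooth (f : Rn -> C) : Prop :=
  smooth (fun x => complex.Re (f x)) /\ smooth (fun x => complex.Im (f x)).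

Definition schwartz_bound (N : nat) (f : Rn -> C) (M : R) : Prop :=
  forall a : seq 'I_n, (size a <= N)%N ->
  forall x : Rn, (1 + sqnorm x) ^+ N * cabs (cpartial a f x) <= M.

Definition schwartz (f : Rn -> C) : Prop :=
  csmooth f /\ forall N : nat, exists M : R, schwartz_bound N f M.

(* A distribution is a functional on C-valued functions of which only the
   values at Schwartz functions matter. *)
Definition tempered (u : (Rn -> C) -> C) : Prop :=
  (forall (c : C) (phi psi : Rn -> C), schwartz phi -> schwartz psi ->
     u (fun x => c * phi x + psi x) = c * u phi + u psi) /\
  (exists (N : nat) (K : R), forall (phi : Rn -> C) (M : R),
     schwartz phi -> schwartz_bound N phi M -> cabs (u phi) <= K * M).

Definition is_function (u : (Rn -> C) -> C) (g : Rn -> C) : Prop :=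
  cmeasurable g /\
  forall phi : Rn -> C, schwartz phi ->
    cintegrable (fun x => g x * phi x) /\
    u phi = cintegral (fun x => g x * phi x).

Definition fourier (f : Rn -> C) (xi : Rn) : C :=
  cintegral (fun x => f x * cis (- dot x xi)).

Definition dfourier (u : (Rn -> C) -> C) : (Rn -> C) -> C :=
  fun phi => u (fourier phi).

Definition sobolev_sqnorm (s : R) (fhat : Rn -> C) : \bar R :=
  (((2 * pi) ^- n)%:E *
   \int[mu]_xi ((1 + sqnorm xi) `^ s * cabs (fhat xi) ^+ 2)%:E)%E.

Definition sobolev_norm (s : R) (fhat : Rn -> C) : R :=
  Num.sqrt (fine (sobolev_sqnorm s fhat)).

(* f belongs to H^s, and fhat is a version of its Fourier transform. *)
Definition in_sobolev (s : R) (f : (Rn -> C) -> C) (fhat : Rn -> C) : Prop :=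
  [/\ tempered f, is_function (dfourier f) fhat &
      (sobolev_sqnorm s fhat < +oo)%E].

Definition peval (P : {mpoly R[n]}) (xi : Rn) : R :=
  mpoly.meval (fun i => xi 0 i) P.

Definition T_schwartz (P : {mpoly R[n]}) (t : R) (f : Rn -> C) (x : Rn) : C :=
  (((2 * pi) ^- n)%:C)%C *
  cintegral (fun xi => fourier f xi * cis (dot x xi + peval P xi * t)).

(* v is a version of the function T_t^P f for f in H^s: the Fourier transform
   of v is e^{iP(xi)t} fhat, and v is given pointwise by the oscillatory
   integral when f is a Schwartz function. *)
Definition is_T (P : {mpoly R[n]}) (t : R) (f : (Rn -> C) -> C)
    (fhat v : Rn -> C) : Prop :=
  [/\ exists2 u : (Rn -> C) -> C, tempered u /\ is_function u v &
        is_function (dfourier u) (fun xi => cis (peval P xi * t) * fhat xi) &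
      forall phi : Rn -> C, schwartz phi -> is_function f phi ->
        v = T_schwartz P t phi].

Definition maximal (u : R -> Rn -> C) (x : Rn) : \bar R :=
  ereal_sup [set (cabs (u t x))%:E | t in [set t : R | 0 < t < 1]].

(* The bound || sup_{0<t<1} |T_t^P f| ||_{L^1(B_n(0,1))} <= K ||f||_{H^s} for
   all f in H^s. Each T_t^P f is an a.e. class and t ranges over an uncountable
   set, so "the" pointwise supremum depends on the versions; the best choice of
   versions realizes the essential supremum of the family. For Schwartz f, is_T
   leaves no choice and this is the classical maximal function. *)
Definition maximal_estimate (P : {mpoly R[n]}) (s K : R) : Prop :=
  forall (f : (Rn -> C) -> C) (fhat : Rn -> C), in_sobolev s f fhat ->
  exists u : R -> Rn -> C,
    [/\ forall t : R, 0 < t < 1 -> is_T P t f fhat (u t),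
        measurable_fun unit_ball (maximal u) &
        (\int[mu]_(x in unit_ball) maximal u x <=
           (K * sobolev_norm s fhat)%:E)%E].

End Analysis.

Section LeadingForm.
Variables (R : realType) (n : nat) (n_gt1 : (1 < n)%N).

Definition first_index : 'I_n := Ordinal (ltnW n_gt1).

Definition mvar (i : 'I_n) : {mpoly R[n]} := mpoly.mpolyX R (mpoly.mnm1 i).

(* R[X_2, ..., X_n] is {mpoly R[n.-1]}, embedded in R[X_1, ..., X_n] by
   shifting the variables past X_1. *)
Definition embed (q : {mpoly R[n.-1]}) : {mpoly R[n]} :=
  mpoly.comp_mpoly [tuple mvar (lift first_index j) | j < n.-1] q.

(* Q j is the form of degree j, so Q_{k-i} is Q (k - i). *)
Definition leading_form (k d : nat) (Q : nat -> {mpoly R[n.-1]}) :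
    {mpoly R[n]} :=
  embed (Q k) + mvar first_index * embed (Q (k - 1)%N) +
  \sum_(d <= i < k.+1) mvar first_index ^+ i * embed (Q (k - i)%N).

End LeadingForm.

Definition total_degree (R : realType) (n : nat) (P : {mpoly R[n]})
    (k : nat) : Prop := mpoly.mmeasure mpoly.mdeg P = k.+1.

Definition is_form (R : realType) (n : nat) (e : nat) (q : {mpoly R[n]}) :
  Prop := q \is mpoly.ishomog1 e mpoly.mdeg.

Definition homog_part (R : realType) (n : nat) (k : nat) (P : {mpoly R[n]}) :
  {mpoly R[n]} := mpoly.pihomog mpoly.mdeg k P.

Definition s_d (R : realType) (d : nat) : R := (d%:R - 1) / (2 * d%:R).

Definition s_infty (R : realType) : R := 2^-1.

(* Main.v *)
Require Import Defs.
From mathcomp Require Import all_boot all_order all_algebra.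
From mathcomp Require Import complex.
From mathcomp Require Import all_classical all_reals all_analysis.
From mathcomp Require Import measurable_realfun.
From mathcomp Require Import (canonicals, coercions) mpoly.
From mathcomp Require Import ring lra.

(* The counterexample is a Gaussian wave packet f. Let v be a point where
   q := Q_{k-1}(v) is nonzero and let fhat be a Gaussian centred at the frequency
   (0, L^D v), of width L^e in the direction of X_1 and of width 1 in the other
   directions, so that L^D plays the role of a large frequency R. On a box of
   positions x, choose the time t with t q R^(k-1) = -x_1; it is of size R^(1-k).
   The phase x.xi + t P(xi) then loses its term linear in xi_1, and what remains
   is constant up to a small error: the terms t xi_1^i Q_{k-i} with i >= d are
   O(1) because xi_1 = O(R^(1-1/d)) (take D = d, e = d - 1), or absent (take
   D = e = 1). Hence the maximal function is bounded below by a constant multiple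
   of the integral of fhat on the whole box, whereas the H^s norm of f is of order
   R^s L^(-e/2) relative to that integral. Letting L tend to infinity gives
   s >= e / (2 D). *)

Set Implicit Arguments.
Unset Strict Implicit.
Unset Printing Implicit Defensive.

Import Order.TTheory GRing.Theory Num.Theory.
Import numFieldNormedType.Exports.

Local Open Scope classical_set_scope.
Local Open Scope ring_scope.

(** * The Fourier transform of a Gaussian on the line *)

Section OneDim.
Variable R : realType.
Local Notation mu := (@lebesgue_measure R).
Implicit Types x y a c sigma : R.

(** The phase error is only bounded by a small constant times a polynomial in the standardised
    frequency Y, so it is not small in the Gaussian tails. It is therefore averaged against moments
    of the Gaussian, which are bounded uniformly in the widths, and the box of positions is shrunk
    to beat that fixed bound. The exponents come from a count: for t of order L^(-D(k-1)) the term t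
    xi_1^i Q_{k-i} has order e i + D(k-i) - D(k-1) in L, which for D = d, e = d - 1 equals d - i.
    Integer powers of L replace fractional powers of R. A Gaussian is convenient because its
    transform is explicit: the packet is defined in space, its transform is computed, and no Fourier
    inversion is needed. Being Schwartz, it leaves no freedom in the versions allowed by
    [maximal_estimate]. That estimate speaks of distributions, however, so the classical transform
    has to be identified with the distributional one by the multiplication formula. Throughout,
    [sigma] is a width in frequency: the profile in space has width 1 / sigma. *)

Definition gauss sigma x : R := expR (- (sigma ^+ 2 / 2) * x ^+ 2).

Lemma gaussE sigma x : sigma != 0 -> gauss sigma x = normal_fun 0 sigma^-1 x.
Proof.
move=> s0; rewrite /gauss /normal_fun subr0; congr expR.
rewrite -[in RHS]mulr_natr; field; by rewrite s0.
Qed.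

Lemma gauss_gt0 sigma x : 0 < gauss sigma x.
Proof. exact: expR_gt0. Qed.

Lemma is_derive_gauss sigma x :
  is_derive x 1 (gauss sigma) (- (sigma ^+ 2) * x * gauss sigma x).
Proof.
rewrite /gauss.
have -> : (fun x => expR (- (sigma ^+ 2 / 2) * x ^+ 2)) =
    expR \o (fun x => - (sigma ^+ 2 / 2) * x ^+ 2) by [].
apply: is_derive_eq.
by rewrite /GRing.scale /= ?mulr1 ?mulr2n; field.
Qed.

Lemma continuous_gauss sigma : continuous (gauss sigma).
Proof.
move=> x; apply/differentiable_continuous/derivable1_diffP.
by case: (is_derive_gauss sigma x).
Qed.

Lemma integral_gauss sigma : sigma != 0 ->
  mu.-integrable setT (EFin \o gauss sigma) /\
  \int[mu]_x gauss sigma x = (normal_peak sigma^-1)^-1.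
Proof.
move=> s0; have v0 : sigma^-1 != 0 by rewrite invr_eq0.
have E x : gauss sigma x = (normal_peak sigma^-1)^-1 * normal_pdf 0 sigma^-1 x.
  by rewrite gaussE// normal_pdfE// mulKf// gt_eqF// normal_peak_gt0.
split.
  rewrite /comp; under eq_fun do rewrite E EFinM.
  by apply: integrableZl => //; exact: integrable_normal_pdf.
under eq_Rintegral do rewrite E.
rewrite RintegralZl//; last exact: integrable_normal_pdf.
by rewrite /Rintegral integral_normal_pdf mulr1.
Qed.

Lemma normal_peakE sigma : 0 < sigma ->
  normal_peak sigma = (sigma * Num.sqrt (pi *+ 2))^-1.
Proof.
move=> s0; rewrite /normal_peak; congr _^-1.
by rewrite -mulrnAr sqrtrM ?sqr_ge0// sqrtr_sqr gtr0_norm.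
Qed.

Lemma le_integrableR d (T : measurableType d)
    (m : {measure set T -> \bar R}) (f g : T -> R) :
  measurable_fun setT f -> (forall z, `|f z| <= g z) ->
  m.-integrable setT (EFin \o g) -> m.-integrable setT (EFin \o f).
Proof.
move=> mf fg; apply: le_integrable => //; first exact/measurable_EFinP.
by move=> z _ /=; rewrite lee_fin (le_trans (fg z))// ler_norm.
Qed.

(* x exp(-b x^2) is dominated by exp(-b x^2 / 2). *)
Lemma integrable_mulx_gauss sigma : sigma != 0 ->
  mu.-integrable setT (EFin \o (fun x => `|x| * gauss sigma x)).
Proof.
move=> s0; pose t := sigma / Num.sqrt 2.
have r0 : Num.sqrt 2 != 0 :> R by rewrite gt_eqF// sqrtr_gt0.
have t0 : t != 0 by rewrite mulf_neq0// invr_eq0.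
have t2 : t ^+ 2 = sigma ^+ 2 / 2.
  by rewrite expr_div_n sqr_sqrtr.
apply: (@le_integrableR _ _ mu _ (fun x => (1 + 4 / sigma ^+ 2) * gauss t x)).
- apply: measurable_funM; first exact: normr_measurable.
  by apply: continuous_measurable_fun; exact: continuous_gauss.
- move=> x; rewrite normrM normr_id (gtr0_norm (gauss_gt0 _ _)).
  have -> : gauss sigma x = gauss t x * gauss t x.
    by rewrite /gauss -expRD t2; congr expR; by field.
  rewrite mulrA ler_pM2r ?gauss_gt0//.
  have s2 : 0 < sigma ^+ 2 by rewrite exprn_even_gt0.
  have h1 : 1 + (sigma ^+ 2 / 4) * x ^+ 2 <= (gauss t x)^-1.
    rewrite /gauss t2 mulNr expRN invrK.
    apply: le_trans (expR_ge1Dx _).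
    by rewrite lerD2l le_eqVlt; apply/orP; left; apply/eqP; by field.
  rewrite -ler_pdivlMr ?gauss_gt0//.
  set A := 1 + 4 / _; have A0 : 0 < A by rewrite addr_gt0// divr_gt0.
  apply: le_trans (_ : A * (1 + (sigma ^+ 2 / 4) * x ^+ 2) <= _); last first.
    by rewrite ler_pM2l.
  have -> : A * (1 + sigma ^+ 2 / 4 * x ^+ 2)
     = 1 + x ^+ 2 + (4 / sigma ^+ 2 + sigma ^+ 2 / 4 * x ^+ 2).
    by rewrite /A; field; exact: s0.
  apply: ler_wpDr.
    have ha : 0 <= 4 / sigma ^+ 2 by rewrite divr_ge0// ltW.
    have hb : 0 <= sigma ^+ 2 / 4 by rewrite divr_ge0// ltW.
    by rewrite addr_ge0// mulr_ge0// sqr_ge0.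
  rewrite -real_normK ?num_real//; have := normr_ge0 x; nra.
- rewrite /comp; under eq_fun do rewrite EFinM.
  by apply: integrableZl => //; case: (integral_gauss t0).
Qed.


(** Boundary terms vanish at infinity: the fundamental theorem on growing symmetric intervals, then
    dominated convergence. These intervals only see the decay of h along the integers. *)
Lemma Rintegral_derive_eq0 (h h' : R -> R) :
  (forall x, is_derive x 1 h (h' x)) -> continuous h' ->
  mu.-integrable setT (EFin \o h') ->
  h n%:R @[n --> \oo] --> 0 -> h (- n%:R) @[n --> \oo] --> 0 ->
  \int[mu]_x h' x = 0.
Proof.
move=> dh ch ih hy hNy.
have mh : measurable_fun setT h' by exact: continuous_measurable_fun.
(* [n.+1] keeps the interval nondegenerate at n = 0, as the fundamental theorem requires. *)
pose I n : set R := `[- (n.+1%:R), n.+1%:R]%classic.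
have FTC n : (\int[mu]_x ((h' \_ (I n)) x)%:E = (h n.+1%:R - h (- n.+1%:R))%:E)%E.
  have -> : (fun x => ((h' \_ (I n)) x)%:E) = ((EFin \o h') \_ (I n)).
    by apply/funext => x; rewrite /patch; case: ifP.
  rewrite -integral_mkcond (@continuous_FTC2 _ _ h)//.
  - by rewrite gtrN// ltr0n.
  - by apply: continuous_subspaceT.
  - split; first by move=> x _; case: (dh x).
      apply: cvg_at_right_filter; apply/differentiable_continuous/derivable1_diffP.
      by case: (dh (- n.+1%:R)).
    apply: cvg_at_left_filter; apply/differentiable_continuous/derivable1_diffP.
    by case: (dh n.+1%:R).
  - by move=> x _; rewrite derive1E; case: (dh x).
have cv : (\int[mu]_x ((h' \_ (I n)) x)%:E @[n --> \oo] --> \int[mu]_x (h' x)%:E)%E.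
  apply: (@dominated_cvg _ _ _ mu setT measurableT
      (fun n x => ((h' \_ (I n)) x)%:E) _ (EFin \o (fun x => `|h' x|))) => //.
  - move=> n; apply/measurable_EFinP.
    apply/(@measurable_restrictT _ _ _ _ (I n) h' (measurable_itv _)).
    exact: measurable_funTS.
  - move=> x _; apply: cvg_near_cst.
    near=> n; rewrite /patch mem_set// /I /= in_itv /= -ler_norml.
    apply/ltW; apply: lt_le_trans (_ : n%:R <= _); last by rewrite ler_nat.
    near: n; exact: nbhs_infty_gtr.
  - exact: integrable_norm.
  - by move=> n x _ /=; rewrite lee_fin /patch; case: ifP => // _; rewrite normr0.
have cv0 : ((h n.+1%:R - h (- n.+1%:R))%:E @[n --> \oo] --> 0%E)%E.
  apply: cvg_EFin; first exact: nearW.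
  rewrite -[X in _ --> X]subr0.
  by apply: cvgB; [rewrite (cvg_shiftS (fun n => h n%:R))
    |rewrite (cvg_shiftS (fun n => h (- n%:R)))].
rewrite (eq_cvg _ _ FTC) in cv.
by rewrite /Rintegral -(cvg_lim _ cv) // (cvg_lim _ cv0).
Unshelve. all: by end_near. Qed.

(** The phase makes the formula stable under slicing: in R^n an outer coordinate contributes a phase
    to the inner integral. The values 0 and pi / 2 later give the real and imaginary parts of the
    transform. *)
Variable th : R.

Let G sigma y := \int[mu]_x (gauss sigma x * cos (x * y + th)).

Lemma integrable_gauss_bounded sigma (f : R -> R) : sigma != 0 ->
  measurable_fun setT f -> (forall x, `|f x| <= 1) ->
  mu.-integrable setT (EFin \o (fun x => gauss sigma x * f x)).
Proof.
move=> s0 mf f1; apply: (@le_integrableR _ _ mu _ (gauss sigma)).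
- apply: measurable_funM => //.
  by apply: continuous_measurable_fun; exact: continuous_gauss.
- by move=> x; rewrite normrM (gtr0_norm (gauss_gt0 _ _)) ler_piMr// ltW// gauss_gt0.
- by case: (integral_gauss s0).
Qed.

Lemma measurable_cos_affine y : measurable_fun setT (fun x : R => cos (x * y + th)).
Proof.
apply: continuous_measurable_fun => x.
apply: continuous_comp; last exact: continuous_cos.
by apply: cvgD; [apply: cvgMl; exact: cvg_id|exact: cvg_cst].
Qed.

Lemma measurable_sin_affine y : measurable_fun setT (fun x : R => sin (x * y + th)).
Proof.
apply: continuous_measurable_fun => x.
apply: continuous_comp; last exact: continuous_sin.
by apply: cvgD; [apply: cvgMl; exact: cvg_id|exact: cvg_cst].
Qed.

Lemma integrable_mulx_gauss_sin sigma y : sigma != 0 ->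
  mu.-integrable setT (EFin \o (fun x => x * gauss sigma x * sin (x * y + th))).
Proof.
move=> s0; apply: le_integrableR (integrable_mulx_gauss s0) => [|x].
  apply: measurable_funM; last exact: measurable_sin_affine.
  apply: measurable_funM => //.
  by apply: continuous_measurable_fun; exact: continuous_gauss.
rewrite !normrM (gtr0_norm (gauss_gt0 _ _)) ler_piMr ?sin_max//.
by rewrite mulr_ge0// ltW// gauss_gt0.
Qed.

(** Differentiation under the integral sign: the bound [|x| * gauss sigma x] on the derivative is
    independent of the parameter. *)
Lemma derive_gauss_cos sigma y : sigma != 0 ->
  is_derive y 1 (G sigma) (- \int[mu]_x (x * gauss sigma x * sin (x * y + th))).
Proof.
move=> s0.
have dcos (x z : R) : is_derive z 1 (fun z => gauss sigma x * cos (x * z + th))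
    (- (x * gauss sigma x * sin (x * z + th))).
  have -> : (fun z => gauss sigma x * cos (x * z + th)) =
     (gauss sigma x \*o (cos \o (( *%R x) \+ cst th))) by [].
  apply: is_derive_eq.
  by rewrite /GRing.scale /= ?mulr1 ?addr0; ring.
have int_f (z : R) : mu.-integrable setT (EFin \o (fun x => gauss sigma x * cos (x * z + th))).
  apply: integrable_gauss_bounded => // [|x]; last exact: cos_max.
  exact: measurable_cos_affine.
pose U : set R := `]y - 1, y + 1[%classic.
have Uy : U y by rewrite /U /= in_itv/= ltrDl ltr01 gtrDl ltrN10.
have D1 (x z : R) : partial1of2 (fun y x => gauss sigma x * cos (x * y + th)) z x =
    - (x * gauss sigma x * sin (x * z + th)).
  by rewrite partial1of2E; case: (dcos x z).
have dom (z x : R) : U z -> setT x ->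
    `|partial1of2 (fun y x => gauss sigma x * cos (x * y + th)) z x| <=
    `|x| * gauss sigma x.
  move=> _ _; rewrite D1 normrN !normrM (gtr0_norm (gauss_gt0 _ _)).
  by rewrite ler_piMr ?sin_max// mulr_ge0// ltW// gauss_gt0.
have g0 (x : R) : 0 <= `|x| * gauss sigma x by rewrite mulr_ge0// ltW// gauss_gt0.
have dd (z x : R) : U z -> setT x -> derivable (fun z => gauss sigma x * cos (x * z + th)) z 1.
  by move=> _ _; case: (dcos x z).
split.
  exact: (derivable_under_integral measurableT Uy (fun z _ => int_f z) dd g0
    (integrable_mulx_gauss s0) dom).
rewrite -derive1E (differentiation_under_integral measurableT Uy (fun z _ => int_f z) dd g0
    (integrable_mulx_gauss s0) dom).
under eq_Rintegral do rewrite D1 -mulN1r.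
by rewrite RintegralZl ?mulN1r//; exact: integrable_mulx_gauss_sin.
Qed.

Lemma cvg_gauss_nat sigma (f : R -> R) : sigma != 0 -> (forall x, `|f x| <= 1) ->
  gauss sigma n%:R * f n%:R @[n --> \oo] --> 0.
Proof.
move=> s0 f1; set a := sigma ^+ 2 / 2.
have a0 : 0 < a by rewrite divr_gt0// exprn_even_gt0.
apply: norm_cvg0.
(* Since n <= n^2, the Gaussian at n is at most the n-th power of exp(-a). *)
apply: (@squeeze_cvgr _ _ _ _ (cst 0) (fun n => expR (- a) ^+ n)).
- apply: nearW => n; rewrite normr_ge0 /= normrM (gtr0_norm (gauss_gt0 _ _)).
  apply: le_trans (_ : gauss sigma n%:R <= _).
    by rewrite ler_piMr// ltW// gauss_gt0.
  rewrite -expRM_natl /gauss ler_expR mulrC -/a !mulrN lerN2 ler_pM2r//.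
  by rewrite -natrX ler_nat; case: n => // n; rewrite expnS expn1 leq_pmulr.
- exact: cvg_cst.
- by apply: cvg_expr; rewrite ger0_norm ?expR_ge0// -expR0 ltr_expR oppr_lt0.
Qed.

(** The derivative of Gaussian times sine has integral zero. Together with [derive_gauss_cos] this
    is the differential equation G' = - (y / sigma^2) G. *)
Lemma Rintegral_mulx_gauss_sin sigma y : sigma != 0 ->
  \int[mu]_x (x * gauss sigma x * sin (x * y + th)) = y / sigma ^+ 2 * G sigma y.
Proof.
move=> s0.
have dh x : is_derive x 1 (fun x => gauss sigma x * sin (x * y + th))
    ((- sigma ^+ 2) * (x * gauss sigma x * sin (x * y + th)) +
     y * (gauss sigma x * cos (x * y + th))).
  have dg := is_derive_gauss sigma x.
  have -> : (fun x => gauss sigma x * sin (x * y + th)) =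
     (gauss sigma \* (sin \o (( *%R ^~ y) \+ cst th))) by [].
  apply: is_derive_eq.
  by rewrite /GRing.scale /= ?mulr1 ?addr0; ring.
have i1 := @integrable_mulx_gauss_sin sigma y s0.
have i2 : mu.-integrable setT (EFin \o (fun x => gauss sigma x * cos (x * y + th))).
  apply: integrable_gauss_bounded => // [|x]; last exact: cos_max.
  exact: measurable_cos_affine.
have j1 : mu.-integrable setT (EFin \o (fun x => (- sigma ^+ 2) * (x * gauss sigma x * sin (x * y + th)))).
  by rewrite /comp; under eq_fun do rewrite EFinM; exact: integrableZl.
have j2 : mu.-integrable setT (EFin \o (fun x => y * (gauss sigma x * cos (x * y + th)))).
  by rewrite /comp; under eq_fun do rewrite EFinM; exact: integrableZl.
have sb x : `|sin (x * y + th)| <= 1 by exact: sin_max.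
have E := Rintegral_derive_eq0 dh.
rewrite RintegralD// !RintegralZl// -/(G sigma y) in E.
set I := \int[mu]_x _ in E *.
have s20 : sigma ^+ 2 != 0 by rewrite expf_neq0.
suff E' : - sigma ^+ 2 * I + y * G sigma y = 0.
  apply: (mulfI s20); rewrite mulrA mulrCA mulfV// mulr1.
  by apply/eqP; rewrite -subr_eq0 -oppr_eq0 opprB -E' addrC mulNr.
apply: E.
- move=> x; apply: cvgD; (apply: cvgM; first exact: cvg_cst).
    apply: cvgM; last first.
      apply: continuous_comp; last exact: continuous_sin.
      by apply: cvgD; [apply: cvgMl; exact: cvg_id|exact: cvg_cst].
    by apply: cvgM; [exact: cvg_id|exact: continuous_gauss].
  apply: cvgM; first exact: continuous_gauss.
  apply: continuous_comp; last exact: continuous_cos.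
  by apply: cvgD; [apply: cvgMl; exact: cvg_id|exact: cvg_cst].
- rewrite /comp; under eq_fun do rewrite EFinD.
  exact: integrableD.
- exact: (@cvg_gauss_nat sigma (fun x => sin (x * y + th))).
- have -> : (fun n : nat => gauss sigma (- n%:R) * sin (- n%:R * y + th)) =
      (fun n : nat => gauss sigma n%:R * (fun x => sin (- x * y + th)) n%:R).
    by apply/funext => n; rewrite /gauss sqrrN.
  exact: (@cvg_gauss_nat sigma (fun x => sin (- x * y + th))).
Qed.

(** By that differential equation G times exp(y^2 / (2 sigma^2)) is constant, and its value at 0 is
    a Gaussian integral times cos th. *)
Lemma fourier_gauss sigma y : 0 < sigma ->
  \int[mu]_x (gauss sigma x * cos (x * y + th)) =
  2 * pi * normal_pdf 0 sigma y * cos th.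
Proof.
move=> sp; have s0 : sigma != 0 by rewrite gt_eqF.
pose e z := expR ((2 * sigma ^+ 2)^-1 * z ^+ 2).
have de (z : R) : is_derive z 1 e (z / sigma ^+ 2 * e z).
  rewrite /e.
  have -> : (fun z => expR ((2 * sigma ^+ 2)^-1 * z ^+ 2)) =
    expR \o (fun z => (2 * sigma ^+ 2)^-1 * z ^+ 2) by [].
  apply: is_derive_eq.
  by rewrite /GRing.scale /= ?mulr1 ?mulr2n; field; exact: s0.
have dK (z : R) : is_derive z 1 (G sigma * e) 0.
  have dG := derive_gauss_cos z s0; have dez := de z.
  apply: is_derive_eq.
  by rewrite Rintegral_mulx_gauss_sin// /GRing.scale /=; ring.
have := is_derive_0_is_cst y 0 dK.
rewrite /GRing.mul /= -/(GRing.mul _ _) => K.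
have {}K : G sigma y * e y = G sigma 0 * e 0 by [].
have e0 : e 0 = 1 by rewrite /e expr0n/= mulr0 expR0.
have G0 : G sigma 0 = (normal_peak sigma^-1)^-1 * cos th.
  have [ig <-] := integral_gauss s0.
  rewrite /G; under eq_Rintegral do rewrite mulr0 add0r.
  by rewrite RintegralZr.
have ey : e y != 0 by rewrite gt_eqF// expR_gt0.
apply: (mulIf ey); rewrite [LHS]K e0 mulr1 G0.
rewrite normal_pdfE// /normal_fun subr0.
have -> : 2 * pi * (normal_peak sigma * expR (- y ^+ 2 / (sigma ^+ 2 *+ 2))) * cos th * e y =
  2 * pi * normal_peak sigma * cos th * (expR (- y ^+ 2 / (sigma ^+ 2 *+ 2)) * e y) by ring.
rewrite /e -expRD -(mulr_natl (sigma ^+ 2)) (_ : _ + _ = 0); last by field; exact: s0.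
rewrite expR0 mulr1; congr (_ * cos th).
rewrite !normal_peakE ?invr_gt0// invrK.
have p0 : 0 < Num.sqrt (pi *+ 2) :> R by rewrite sqrtr_gt0 pmulrn_lgt0// pi_gt0.
have -> : 2 * pi = Num.sqrt (pi *+ 2) ^+ 2 :> R.
  by rewrite sqr_sqrtr ?mulr_natl// mulrn_wge0// pi_ge0.
by field; rewrite s0 gt_eqF.
Qed.

End OneDim.

(** * Integration on R^n *)

Section RowVectorIntegral.
Variable R : realType.
Local Notation leb := (@lebesgue_measure R).
Local Notation mu := (lebesgue_rV R).

Lemma ge0_integral_rVS n (f : 'rV[R]_n.+1 -> \bar R) :
  measurable_fun setT f -> (forall x, (0 <= f x)%E) ->
  (\int[mu n.+1]_x f x = \int[leb]_a \int[mu n]_y f (rVcons (a, y)))%E.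
Proof.
move=> mf f0.
have mcons := @measurable_rVcons R n.
transitivity (\int[(leb \x mu n)%E]_z f (rVcons z))%E.
  exact: (@ge0_integral_pushforward _ _ _ _ R _ mcons (leb \x mu n)%E setT f).
rewrite (@fubini_tonelli1 _ _ _ _ _ leb (mu n) (f \o @rVcons R n)) //.
  exact: measurableT_comp.
by move=> z; exact: f0.
Qed.

Lemma integral_rVS n (f : 'rV[R]_n.+1 -> R) :
  (mu n.+1).-integrable setT (EFin \o f) ->
  (\int[mu n.+1]_x (f x)%:E = \int[leb]_a \int[mu n]_y (f (rVcons (a, y)))%:E)%E.
Proof.
move=> intf; have mf := measurable_int _ intf.
have mcons := @measurable_rVcons R n.
have i2 : (leb \x mu n)%E.-integrable setT ((EFin \o f) \o @rVcons R n).
  apply/integrableP; split; first exact: measurableT_comp.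
  move/integrableP : intf => [_]; apply: le_lt_trans.
  rewrite le_eqVlt; apply/orP; left; apply/eqP/esym.
  apply: (@ge0_integral_pushforward _ _ _ _ R _ mcons (leb \x mu n)%E setT
    (fun x => `|(f x)%:E|%E)) => //.
  exact: measurableT_comp.
transitivity (\int[(leb \x mu n)%E]_z (f (rVcons z))%:E)%E.
  exact: (@integral_pushforward _ _ _ _ R _ mcons (leb \x mu n)%E setT (EFin \o f)).
by rewrite -(integral12_prod_meas1 i2).
Qed.

Lemma measurable_coord_comp n (i : 'I_n) (g : R -> R) :
  measurable_fun setT g -> measurable_fun setT (fun x : 'rV[R]_n => g (x 0 i)).
Proof.
move=> mg; apply: (@measurableT_comp _ _ _ _ _ _ g) => //.
exact: measurable_coord.
Qed.

Lemma measurable_prod_coord n (f : 'I_n -> R -> R) :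
  (forall i, measurable_fun setT (f i)) ->
  measurable_fun setT (fun x : 'rV[R]_n => \prod_i f i (x 0 i)).
Proof.
move=> mf; apply: measurable_prod => i _.
by apply: measurable_coord_comp.
Qed.

Lemma integral_prod_coord n (f : 'I_n -> R -> R) (c : 'I_n -> R) :
  (forall i, measurable_fun setT (f i)) -> (forall i x, 0 <= f i x) ->
  (forall i, \int[leb]_x (f i x)%:E = (c i)%:E)%E ->
  (\int[mu n]_x (\prod_i f i (x 0 i))%:E = (\prod_i c i)%:E)%E.
Proof.
elim: n f c => [|n IH] f c mf f0 fc.
  under eq_integral do rewrite big_ord0.
  by rewrite big_ord0 integral_cst//= diracT mule1.
rewrite ge0_integral_rVS; last 2 first.
- by apply/measurable_EFinP; exact: (measurable_prod_coord mf).
- by move=> x; rewrite lee_fin prodr_ge0.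
have E a : (\int[mu n]_y (\prod_i f i (rVcons (a, y) 0 i))%:E =
    (\prod_i c (lift ord0 i))%:E * (f ord0 a)%:E)%E.
  under eq_integral => y _.
    rewrite big_ord_recl rVcons0 /= EFinM.
    under eq_bigr do rewrite rVconsS /=.
    over.
  rewrite ge0_integralZl//.
  - by rewrite (IH (fun i => f (lift ord0 i)) (fun i => c (lift ord0 i)))// muleC.
  - apply/measurable_EFinP.
    exact: (@measurable_prod_coord n (fun i => f (lift ord0 i))).
  - by move=> y _; rewrite lee_fin prodr_ge0.
  - by rewrite lee_fin.
under eq_integral do rewrite E.
rewrite ge0_integralZl//; first by rewrite fc -EFinM mulrC big_ord_recl.
- by apply/measurable_EFinP; exact: mf.
- by move=> a _; rewrite lee_fin.
- rewrite lee_fin prodr_ge0// => i _.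
  by rewrite -lee_fin -fc integral_ge0// => x _; rewrite lee_fin.
Qed.

Lemma integrable_prod_coord n (f : 'I_n -> R -> R) (c : 'I_n -> R) :
  (forall i, measurable_fun setT (f i)) -> (forall i x, 0 <= f i x) ->
  (forall i, \int[leb]_x (f i x)%:E = (c i)%:E)%E ->
  (mu n).-integrable setT (EFin \o (fun x : 'rV[R]_n => \prod_i f i (x 0 i))).
Proof.
move=> mf f0 fc; apply/integrableP; split.
  by apply/measurable_EFinP; exact: (measurable_prod_coord mf).
under eq_integral => x _.
  rewrite /= ger0_norm; last by rewrite prodr_ge0.
  over.
by rewrite (integral_prod_coord mf f0 fc) ltry.
Qed.

(** The sigma-algebra is generated by the coordinates, whereas continuity refers to the sup-norm
    topology. An open set is the union of the rational cubes inside it, and there are countably many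
    of these. *)
Lemma continuous_measurable_rV n (f : 'rV[R]_n -> R) :
  continuous f -> measurable_fun setT f.
Proof.
move=> /continuousP cf; apply: (measurability _ (RGenOpens.measurableE R)).
move=> _ [_ [a [b ->] <-]]; rewrite setTI.
have oV := cf _ (@interval_open R (BRight a) (BLeft b) isT isT); set V := f @^-1` _ in oV *.
pose box (p : 'rV[rat]_n * rat) : set 'rV[R]_n :=
  [set x | forall i, `|ratr (p.1 0 i) - x 0 i| < ratr p.2].
have mbox p : measurable (box p).
  rewrite (_ : box p = \bigcap_(i in [set: 'I_n])
     ((fun x => x 0 i) @^-1` (ball (ratr (p.1 0 i) : R) (ratr p.2)))).
    apply: fin_bigcap_measurable; first exact: finite_finset.
    move=> i _; rewrite -[X in measurable X]setTI; apply: measurable_coord => //.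
    exact: measurable_ball.
  by apply/seteqP; split=> x /= Bx i => [_|]; exact: Bx.
rewrite (_ : V = \bigcup_p (if `[< box p `<=` V >] then box p else set0)).
  by apply: countable_bigcupT_measurable => // p; case: ifP.
apply/seteqP; split=> [x Vx|x [p _]]; last by case: ifPn => // /asboolP + /= => /[apply].
have := oV; rewrite openE => /(_ _ Vx) /nbhs_ballP[e /= e0 xeV].
(* A cube of radius r whose centre is within r of x lies in the ball of radius 2 r < e about x. *)
have [r /andP[r0 re]] : exists r : rat, 0 < (ratr r : R) < e / 2.
  have /rat_in_itvoo[r] : 0 < e / 2 by rewrite divr_gt0.
  by rewrite in_itv /= => rr; exists r.
have /choice[q qx] : forall i : 'I_n, exists q : rat, `|ratr q - x 0 i| < ratr r.
  move=> i; have : x 0 i - ratr r < x 0 i + ratr r by lra.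
  move=> /rat_in_itvoo[q]; rewrite in_itv /= => qq; exists q.
  by rewrite ltr_distl; lra.
exists ((\row_i q i), r) => //; rewrite ifT; first by move=> i; rewrite mxE.
apply/asboolP => y /= Hy; apply: xeV; split => // i j.
rewrite (ord1 i) /ball /=; have := Hy j; have := qx j; rewrite mxE => h1 h2.
rewrite -(subrKA (ratr (q j))); apply: le_lt_trans (ler_normD _ _) _.
by rewrite distrC; lra.
Qed.

Lemma continuous_dot n (y : 'rV[R]_n) : continuous (fun x : 'rV[R]_n => dot x y).
Proof.
rewrite /dot; apply: continuous_big => [|i _ x]; first exact: add_continuous.
exact: (cvgM (@coord_continuous R 1 n 0 i x) (cvg_cst _)).
Qed.

Lemma dotC n (x y : 'rV[R]_n) : dot x y = dot y x.
Proof. by apply: eq_bigr => i _; rewrite mulrC. Qed.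

Lemma measurable_cos_dot n (y : 'rV[R]_n) th :
  measurable_fun setT (fun x : 'rV[R]_n => cos (dot x y + th)).
Proof.
apply: continuous_measurable_rV => x.
apply: continuous_comp; last exact: continuous_cos.
exact: (cvgD (@continuous_dot _ y x) (cvg_cst _)).
Qed.

Lemma measurable_gauss sigma : measurable_fun setT (@gauss R sigma).
Proof. by apply: continuous_measurable_fun; exact: continuous_gauss. Qed.

Lemma integral_gaussE (sigma : R) : 0 < sigma ->
  (\int[leb]_x (gauss sigma x)%:E = (\int[leb]_x gauss sigma x)%:E)%E.
Proof.
move=> s0; have [|ig _] := @integral_gauss R sigma; first by rewrite gt_eqF.
by rewrite /Rintegral fineK//; exact: integrable_fin_num ig.
Qed.

Lemma integrable_prod_gauss_cos n (sigma : 'I_n -> R) (y : 'rV[R]_n) (th : R) :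
  (forall i, 0 < sigma i) ->
  (mu n).-integrable setT (EFin \o (fun x : 'rV[R]_n =>
    (\prod_i gauss (sigma i) (x 0 i)) * cos (dot x y + th))).
Proof.
move=> s0; have mg i := @measurable_gauss (sigma i).
have g0 i x : 0 <= gauss (sigma i) x by rewrite ltW// gauss_gt0.
apply: le_integrableR
    (integrable_prod_coord mg g0 (fun i => integral_gaussE (s0 i))).
  apply: measurable_funM; last exact: measurable_cos_dot.
  exact: (measurable_prod_coord mg).
move=> x; rewrite normrM ger0_norm ?prodr_ge0//.
by rewrite ler_piMr ?prodr_ge0 ?cos_max.
Qed.

(** Induction by slicing off the first coordinate a, whose contribution to the scalar product joins
    the phase; hence the induction is over all [th]. *)
Lemma fourier_gauss_rV n (sigma : 'I_n -> R) (y : 'rV[R]_n) (th : R) :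
  (forall i, 0 < sigma i) ->
  (\int[mu n]_x ((\prod_i gauss (sigma i) (x 0 i)) * cos (dot x y + th))%:E =
   ((\prod_i (2 * pi * normal_pdf 0 (sigma i) (y 0 i))) * cos th)%:E)%E.
Proof.
elim: n sigma y th => [|n IH] sigma y th s0.
  under eq_integral do rewrite /dot !big_ord0 add0r mul1r.
  by rewrite !big_ord0 mul1r integral_cst//= diracT mule1.
rewrite integral_rVS; last exact: integrable_prod_gauss_cos.
pose y' : 'rV[R]_n := \row_j y 0 (lift ord0 j).
set c := \prod_(i < n) (2 * pi * normal_pdf 0 (sigma (lift ord0 i)) (y 0 (lift ord0 i))).
have E a : (\int[mu n]_x ((\prod_i gauss (sigma i) (rVcons (a, x) 0 i)) *
      cos (dot (rVcons (a, x)) y + th))%:E =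
    c%:E * (gauss (sigma ord0) a * cos (a * y 0 ord0 + th))%:E)%E.
  transitivity (\int[mu n]_x ((gauss (sigma ord0) a)%:E *
     ((\prod_i gauss (sigma (lift ord0 i)) (x 0 i)) *
       cos (dot x y' + (a * y 0 ord0 + th)))%:E))%E.
    apply: eq_integral => x _.
    rewrite big_ord_recl rVcons0 /dot big_ord_recl rVcons0 /= EFinM -EFinM -EFinM mulrA.
    congr (_ * _ * cos _)%:E; first by apply: eq_bigr => i _; rewrite rVconsS.
    rewrite addrA [in RHS](addrC (\sum_(_ < _) _)); congr (_ + _ + _).
    by apply: eq_bigr => i _; rewrite rVconsS mxE.
  rewrite integralZl//; last exact: integrable_prod_gauss_cos.
  rewrite (IH (fun i => sigma (lift ord0 i)))// -!EFinM mulrCA.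
  congr (_ * _)%:E; apply: eq_bigr => i _; by rewrite mxE.
under eq_integral do rewrite E.
have s00 : sigma ord0 != 0 by rewrite gt_eqF.
have ig : leb.-integrable setT (EFin \o (fun a => gauss (sigma ord0) a * cos (a * y 0 ord0 + th))).
  apply: integrable_gauss_bounded => // [|x]; last exact: cos_max.
  exact: measurable_cos_affine.
rewrite integralZl// -[X in (_ * X)%E]fineK; last exact: integrable_fin_num ig.
rewrite -/(Rintegral _ _ _) fourier_gauss// big_ord_recl -EFinM.
by rewrite -/c; congr EFin; ring.
Qed.

End RowVectorIntegral.

(** * Decay of wave packets *)

Section WavePackets.
Variables (R : realType) (n : nat).
Local Notation Rn := 'rV[R]_n.
Implicit Types (f g p q : Rn -> R) (x y c : Rn).

(** The partial derivatives are named as functions, so that the stability of a class under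
    differentiation can be read off from them. *)
Definition has_grad f (D : 'I_n -> Rn -> R) := forall x,
  differentiable f x /\ forall i, 'D_(delta_mx 0 i) f x = D i x.

Lemma has_grad_cst (a : R) : has_grad (fun=> a) (fun _ _ => 0).
Proof.
by move=> x; split=> [|i]; [exact: differentiable_cst|exact: derive_cst].
Qed.

Lemma has_grad_coord (j : 'I_n) : has_grad (fun x => x 0 j) (fun i _ => (i == j)%:R).
Proof.
move=> x; have dx : differentiable (fun x : Rn => x 0 j) x.
  exact: differentiable_coord.
(* The coordinate is packaged as a linear map, which is its own differential. *)
split=> // i; have @f : {linear Rn -> R}.
  by exists (fun N : Rn => N 0 j); do 2![eexists]; do ?[constructor];
     rewrite ?mxE// => ? *; rewrite ?mxE//; move=> ?; rewrite !mxE.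
rewrite deriveE// (_ : (fun x : Rn => x 0 j) = f)//.
rewrite (@diff_lin _ _ _ f) /f/= ?mxE ?eqxx ?[j == i]eq_sym//.
exact: coord_continuous.
Qed.

Lemma has_gradD f g D E : has_grad f D -> has_grad g E ->
  has_grad (fun x => f x + g x) (fun i x => D i x + E i x).
Proof.
move=> hf hg x; have [df f'] := hf x; have [dg g'] := hg x.
split=> [|i]; first exact: differentiableD.
rewrite -f' -g'; apply: deriveD; exact: diff_derivable.
Qed.

Lemma has_gradM f g D E : has_grad f D -> has_grad g E ->
  has_grad (fun x => f x * g x) (fun i x => f x * E i x + g x * D i x).
Proof.
move=> hf hg x; have [df f'] := hf x; have [dg g'] := hg x.
split=> [|i]; first exact: differentiableM.
rewrite -f' -g'; apply: deriveM; exact: diff_derivable.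
Qed.

Lemma has_grad_comp (h h' : R -> R) f D : (forall t : R, is_derive t 1 h (h' t)) ->
  has_grad f D -> has_grad (fun x => h (f x)) (fun i x => h' (f x) * D i x).
Proof.
move=> hh hf x; have [df f'] := hf x.
have [dh h'E] := hh (f x).
have dh' : differentiable h (f x) by exact/derivable1_diffP.
have dc : differentiable (h \o f) x by exact: differentiable_comp.
split=> // i; rewrite -f' deriveE// (_ : (fun x => h (f x)) = h \o f)// diff_comp//=.
have L (r : R) : 'd h (f x) r = 'd h (f x) 1 * r.
  by rewrite -[in LHS](mulr1 r) -[r * 1]/(r *: (1:R)) linearZ/= mulrC.
by rewrite L -h'E !deriveE.
Qed.

(** Polynomial functions are generated inductively, so that gradients and growth bounds follow by
    induction on the construction instead of by sums over monomials. *)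
Inductive polyfun : (Rn -> R) -> Prop :=
| Polyfun_cst a : polyfun (fun=> a)
| Polyfun_coord i : polyfun (fun x => x 0 i)
| PolyfunD p q : polyfun p -> polyfun q -> polyfun (fun x => p x + q x)
| PolyfunM p q : polyfun p -> polyfun q -> polyfun (fun x => p x * q x).

Lemma polyfun_sum (I : Type) (r : seq I) (p : I -> Rn -> R) :
  (forall i, polyfun (p i)) -> polyfun (fun x => \sum_(i <- r) p i x).
Proof.
move=> pp; elim: r => [|i r IH].
  by under eq_fun do rewrite big_nil; exact: Polyfun_cst.
by under eq_fun do rewrite big_cons; exact: PolyfunD.
Qed.

Lemma polyfun_grad p : polyfun p ->
  exists D, has_grad p D /\ forall i, polyfun (D i).
Proof.
elim=> [a|i|{}p q hp [D [gD pD]] hq [E [gE pE]]|{}p q hp [D [gD pD]] hq [E [gE pE]]].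
- eexists; split; first exact: has_grad_cst.
  by move=> i; exact: Polyfun_cst.
- eexists; split; first exact: has_grad_coord.
  by move=> j; exact: Polyfun_cst.
- eexists; split; first exact: has_gradD gD gE.
  by move=> i; exact: PolyfunD.
- eexists; split; first exact: has_gradM gD gE.
  by move=> i; apply: PolyfunD; exact: PolyfunM.
Qed.

Lemma sqr_coord_le x (i : 'I_n) : x 0 i ^+ 2 <= sqnorm x.
Proof.
rewrite /sqnorm /dot (bigD1 i)//= expr2 lerDl sumr_ge0// => j _.
by rewrite -expr2 sqr_ge0.
Qed.

Lemma sqnorm_ge0 x : 0 <= sqnorm x.
Proof. by rewrite sumr_ge0// => j _; rewrite -expr2 sqr_ge0. Qed.

Lemma polyfun_bound p : polyfun p ->
  exists (M : R) (m : nat), 0 <= M /\ forall x, `|p x| <= M * (1 + sqnorm x) ^+ m.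
Proof.
have X1 x : 1 <= 1 + sqnorm x by rewrite lerDl sqnorm_ge0.
elim=> [a|i|{}p q _ [M [m [M0 hp]]] _ [K [k [K0 hq]]]|{}p q _ [M [m [M0 hp]]] _ [K [k [K0 hq]]]].
- by exists `|a|, 0%N; split => // x; rewrite expr0 mulr1.
- exists 1, 1%N; split => // x; rewrite mul1r expr1.
  have := sqr_coord_le x i; rewrite -(real_normK (num_real (x 0 i))) => h.
  have := normr_ge0 (x 0 i); nra.
- exists (M + K), (m + k)%N; split; first exact: addr_ge0.
  move=> x; apply: le_trans (ler_normD _ _) _; rewrite mulrDl lerD//.
    apply: le_trans (hp x) _; rewrite ler_wpM2l// ler_weXn2l ?leq_addr//.
  by apply: le_trans (hq x) _; rewrite ler_wpM2l// ler_weXn2l ?leq_addl.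
- exists (M * K), (m + k)%N; split; first exact: mulr_ge0.
  by move=> x; rewrite normrM exprD mulrACA ler_pM.
Qed.

(* For u = 1 + t^2, exp(a u) = exp(a u / m)^m >= (a u / m)^m. *)
Lemma gauss_decay (sigma : R) (m : nat) : sigma != 0 ->
  exists M, forall t, (1 + t ^+ 2) ^+ m * gauss sigma t <= M.
Proof.
move=> s0; pose a := sigma ^+ 2 / 2; have a0 : 0 < a by rewrite divr_gt0// exprn_even_gt0.
case: m => [|m].
  exists 1 => t; rewrite expr0 mul1r /gauss -/a -[leRHS]expR0 ler_expR mulNr oppr_le0.
  by rewrite mulr_ge0 ?sqr_ge0 ?(ltW a0).
exists (expR a * (m.+1%:R / a) ^+ m.+1) => t.
set u := 1 + t ^+ 2; have u0 : 0 <= u by rewrite addr_ge0// sqr_ge0.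
have -> : gauss sigma t = expR a * expR (- (a * u)).
  by rewrite -expRD /gauss /u -/a; congr expR; ring.
rewrite mulrCA ler_pM2l ?expR_gt0// expRN ler_pdivrMr ?expR_gt0//.
have -> : expR (a * u) = expR (a * u / m.+1%:R) ^+ m.+1.
  by rewrite -expRM_natl [m.+1%:R * _]mulrC divfK.
rewrite -exprMn lerXn2r ?nnegrE ?mulr_ge0 ?expR_ge0 ?invr_ge0 ?(ltW a0)//.
have E (k b v : R) : k != 0 -> b != 0 -> k / b * (b * v / k) = v.
  by move=> k0 b0; field; rewrite k0.
rewrite -[leLHS](E m.+1%:R a) ?pnatr_eq0 ?gt_eqF//.
rewrite ler_pM2l ?divr_gt0//.
  by apply: le_trans (expR_ge1Dx _); rewrite lerDr.
by rewrite exprn_even_gt0.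
Qed.

Variables (sigma : 'I_n -> R) (sigma0 : forall i, sigma i != 0).

Definition prod_gauss x : R := \prod_i gauss (sigma i) (x 0 i).

Lemma prod_gauss_gt0 x : 0 < prod_gauss x.
Proof. by rewrite prodr_gt0// => i _; exact: gauss_gt0. Qed.

Lemma prod_gaussE x :
  prod_gauss x = expR (\sum_i - (sigma i ^+ 2 / 2) * (x 0 i * x 0 i)).
Proof. by rewrite expR_sum; apply: eq_bigr => i _; rewrite /gauss expr2. Qed.

(** Turns a weight in |x|^2 into a product of weights in the coordinates; decay and moments of
    product Gaussians thereby reduce to one dimension. *)
Lemma sqnorm_prod_le x : 1 + sqnorm x <= \prod_i (1 + x 0 i ^+ 2).
Proof.
rewrite /sqnorm /dot.
(* Nonnegativity of the partial sum is carried along, because the inductive step drops the product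
   of that sum with the new square. *)
suff [] : 0 <= \sum_i x 0 i * x 0 i /\
  1 + \sum_i x 0 i * x 0 i <= \prod_i (1 + x 0 i ^+ 2) by [].
elim/big_rec2 : _ => [|i u v _ [v0 h]]; first by rewrite addr0.
rewrite -expr2; have := sqr_ge0 (x 0 i); set w := _ ^+ 2 => w0.
split; first exact: addr_ge0.
apply: le_trans (_ : (1 + w) * (1 + u) <= _); first by nra.
by rewrite ler_pM2l//; lra.
Qed.

(** This class contains the real and imaginary parts of a packet and is stable under partial
    derivatives, so smoothness and decay are checked once for the whole class. *)
Definition wave c f := exists p q, [/\ polyfun p, polyfun q &
  f = fun x => prod_gauss x * (p x * cos (dot x c) + q x * sin (dot x c))].

Lemma wave_grad c f : wave c f ->
  exists D, has_grad f D /\ forall i, wave c (D i).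
Proof.
move=> [p [q [pp pq ->]]].
pose Q x : R := \sum_i - (sigma i ^+ 2 / 2) * (x 0 i * x 0 i).
have pQ : polyfun Q.
  apply: polyfun_sum => i; apply: PolyfunM; first exact: Polyfun_cst.
  by apply: PolyfunM; exact: Polyfun_coord.
have pl : polyfun (fun x => dot x c).
  by apply: polyfun_sum => i; apply: PolyfunM; [exact: Polyfun_coord|exact: Polyfun_cst].
have [Dp [gp pDp]] := polyfun_grad pp.
have [Dq [gq pDq]] := polyfun_grad pq.
have [DQ [gQ pDQ]] := polyfun_grad pQ.
have [Dl [gl pDl]] := polyfun_grad pl.
have gE := has_grad_comp (@is_derive_expR R) gQ.
have gC := has_grad_comp (@is_derive_cos R) gl.
have gS := has_grad_comp (@is_derive_sin R) gl.
have g := has_gradM gE (has_gradD (has_gradM gp gC) (has_gradM gq gS)).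
eexists; split.
  rewrite (_ : (fun x => _) = (fun x => expR (Q x) *
    (p x * cos (dot x c) + q x * sin (dot x c)))); first exact: g.
  by apply/funext => x; rewrite prod_gaussE.
move=> i /=.
(* The Gaussian contributes [DQ] to both coefficients; differentiating cosine and sine exchanges the
   coefficients, with a sign. *)
exists (fun x => Dp i x + (DQ i x * p x + q x * Dl i x)).
exists (fun x => Dq i x + (DQ i x * q x + -1 * (p x * Dl i x))); split.
- by apply: PolyfunD => //; apply: PolyfunD; exact: PolyfunM.
- apply: PolyfunD => //; apply: PolyfunD; first exact: PolyfunM.
  by apply: PolyfunM; [exact: Polyfun_cst|exact: PolyfunM].
- by apply/funext => x; rewrite prod_gaussE -/(Q x); ring.
Qed.

Lemma wave_partial c f (a : seq 'I_n) : wave c f -> wave c (partial a f).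
Proof.
move=> wf; elim: a => [//|i a IH] /=.
have [D [gD wD]] := wave_grad IH.
rewrite (_ : (fun x => _) = D i)//.
by apply/funext => x; have [_ ->] := gD x.
Qed.

Lemma wave_smooth c f : wave c f -> smooth f.
Proof.
move=> wf a x; have [D [gD _]] := wave_grad (wave_partial a wf).
by have [] := gD x.
Qed.

Lemma prod_gauss_decay m : exists M, forall x, (1 + sqnorm x) ^+ m * prod_gauss x <= M.
Proof.
have /choice[M hM] i := gauss_decay m (sigma0 i).
exists (\prod_i M i) => x.
apply: le_trans (_ : (\prod_i (1 + x 0 i ^+ 2)) ^+ m * prod_gauss x <= _).
  rewrite ler_pM2r ?prod_gauss_gt0//.
  have h0 : 0 <= 1 + sqnorm x by rewrite addr_ge0// sqnorm_ge0.
  by rewrite lerXn2r ?nnegrE ?(le_trans h0)// sqnorm_prod_le.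
rewrite -prodrXl -big_split /= ler_prod// => i _; rewrite hM andbT.
by rewrite mulr_ge0 ?exprn_ge0 ?addr_ge0 ?sqr_ge0// ltW// gauss_gt0.
Qed.

(** The polynomial coefficients only raise the exponent of the weight that the Gaussian has to
    absorb. *)
Lemma wave_decay c f m : wave c f ->
  exists M, forall x, (1 + sqnorm x) ^+ m * `|f x| <= M.
Proof.
move=> [p [q [pp pq ->]]].
have [M [k [M0 hp]]] := polyfun_bound pp.
have [K [l [K0 hq]]] := polyfun_bound pq.
have [A hA] := prod_gauss_decay (m + (k + l)).
have X1 x : 1 <= 1 + sqnorm x by rewrite lerDl sqnorm_ge0.
exists ((M + K) * A) => x.
have E0 := prod_gauss_gt0 x.
have b : `|p x * cos (dot x c) + q x * sin (dot x c)| <=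
    (M + K) * (1 + sqnorm x) ^+ (k + l).
  apply: le_trans (ler_normD _ _) _; rewrite !normrM mulrDl lerD//.
    apply: le_trans (_ : `|p x| <= _); first by rewrite ler_piMr ?cos_max.
    by apply: le_trans (hp x) _; rewrite ler_wpM2l// ler_weXn2l ?leq_addr.
  apply: le_trans (_ : `|q x| <= _); first by rewrite ler_piMr ?sin_max.
  by apply: le_trans (hq x) _; rewrite ler_wpM2l// ler_weXn2l ?leq_addl.
rewrite normrM (gtr0_norm E0).
apply: le_trans (_ : (M + K) * ((1 + sqnorm x) ^+ (m + (k + l)) * prod_gauss x) <= _); last first.
  by rewrite ler_wpM2l// addr_ge0.
rewrite exprD (_ : _ * (_ * _ * _) = (1 + sqnorm x) ^+ m * (prod_gauss x * ((M + K) * (1 + sqnorm x) ^+ (k + l)))); last by ring.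
by rewrite ler_wpM2l ?exprn_ge0 ?(le_trans _ (X1 x))// ler_pM2l.
Qed.

End WavePackets.

(** * Schwartz functions *)

Section Schwartz.
Variables (R : realType) (n : nat).
Local Notation Rn := 'rV[R]_n.
Local Notation C := R[i].
Local Notation mu := (lebesgue_rV R n).
Local Notation Re := (@complex.Re R).
Local Notation Im := (@complex.Im R).
Implicit Types (f g psi : Rn -> C) (x y c : Rn) (z : C).

Lemma cabs_le z : cabs z <= `|Re z| + `|Im z|.
Proof.
case: z => a b; rewrite /cabs /=.
rewrite -[leRHS]ger0_norm ?addr_ge0// -sqrtr_sqr ler_wsqrtr//.
rewrite sqrrD !real_normK ?num_real// lerD2r lerDl.
by rewrite mulrn_wge0// mulr_ge0.
Qed.

Lemma Re_le_cabs z : `|Re z| <= cabs z.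
Proof.
case: z => a b; rewrite /cabs /= -sqrtr_sqr ler_wsqrtr//.
by rewrite lerDl sqr_ge0.
Qed.

Lemma Im_le_cabs z : `|Im z| <= cabs z.
Proof.
case: z => a b; rewrite /cabs /= -sqrtr_sqr ler_wsqrtr//.
by rewrite lerDr sqr_ge0.
Qed.

Lemma cabsM z w : cabs (z * w) = cabs z * cabs w.
Proof. exact: Normc.normcM. Qed.

Lemma cabs_ge0 z : 0 <= cabs z.
Proof. by case: z => a b; exact: sqrtr_ge0. Qed.

Lemma cabs_cis (t : R) : cabs (cis t) = 1.
Proof. by rewrite /cabs /= cos2Dsin2 sqrtr1. Qed.

Lemma cReM z w : Re (z * w) = Re z * Re w - Im z * Im w.
Proof. by case: z w => [a b] [u v]. Qed.

Lemma cImM z w : Im (z * w) = Re z * Im w + Im z * Re w.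
Proof. by case: z w => [a b] [u v] /=. Qed.

Lemma ceqP z w : Re z = Re w -> Im z = Im w -> z = w.
Proof. by case: z w => [a b] [u v] /= -> ->. Qed.

(** The Gaussian profile modulated by exp(i x.c), which centres the transform at c. *)
Definition packet (sigma : 'I_n -> R) c x : C :=
  (prod_gauss sigma x * cos (dot x c) +i* (prod_gauss sigma x * sin (dot x c)))%C.

Lemma schwartz_packet (sigma : 'I_n -> R) c : (forall i, sigma i != 0) ->
  schwartz (packet sigma c).
Proof.
move=> s0.
have wR : wave sigma c (fun x => Re (packet sigma c x)).
  exists (fun=> 1), (fun=> 0); split; try exact: Polyfun_cst.
  by apply/funext => x /=; rewrite mul1r mul0r addr0.
have wI : wave sigma c (fun x => Im (packet sigma c x)).
  exists (fun=> 0), (fun=> 1); split; try exact: Polyfun_cst.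
  by apply/funext => x /=; rewrite mul1r mul0r add0r.
split; first by split; [exact: (wave_smooth wR)|exact: (wave_smooth wI)].
move=> N.
(* Index sequences of length at most N form a finite type, so the sum of their individual bounds is
   a common bound. *)
have dec (a : N.-bseq 'I_n) : exists M, forall x,
    (1 + sqnorm x) ^+ N * cabs (cpartial a (packet sigma c) x) <= M.
  have [A hA] := wave_decay s0 N (wave_partial a wR).
  have [B hB] := wave_decay s0 N (wave_partial a wI).
  exists (A + B) => x; apply: le_trans (lerD (hA x) (hB x)).
  rewrite -mulrDr ler_wpM2l ?exprn_ge0 ?addr_ge0 ?sqnorm_ge0//.
  exact: cabs_le.
have /choice[M hM] := dec.
exists (\sum_(a : N.-bseq 'I_n) `|M a|) => a sa x.
apply: le_trans (hM (Bseq sa) x) _.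
rewrite (bigD1 (Bseq sa))//= (le_trans (ler_norm _))// lerDl sumr_ge0//.
Qed.

Lemma schwartz_measurable psi : schwartz psi -> cmeasurable psi.
Proof.
move=> [[sR sI] _]; split; apply: continuous_measurable_rV => x;
  apply: differentiable_continuous; [exact: (sR [::])|exact: (sI [::])].
Qed.

Lemma schwartz_bounded psi : schwartz psi -> exists M, forall x, cabs (psi x) <= M.
Proof.
move=> [_ /(_ 0%N)[M hM]]; exists M => x.
have := hM [::] isT x; rewrite expr0 mul1r; congr (cabs _ <= _).
by rewrite /cpartial /=; case: (psi x).
Qed.

Lemma measurable_cabs f : cmeasurable f -> measurable_fun setT (fun x => cabs (f x)).
Proof.
move=> [mR mI].
rewrite (_ : (fun x => _) = (fun x => Num.sqrt (Re (f x) ^+ 2 + Im (f x) ^+ 2))).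
  apply: (@measurableT_comp _ _ _ _ _ _ (@Num.sqrt R)).
    by apply: continuous_measurable_fun; exact: sqrt_continuous.
  by apply: measurable_funD; apply: measurable_funX.
by apply/funext => x; case: (f x).
Qed.

Lemma integrable_cabs f : cmeasurable f ->
  cintegrable f <-> mu.-integrable setT (EFin \o (fun x => cabs (f x))).
Proof.
move=> [mR mI]; split=> [[iR iI]|iA]; last first.
  by split; [apply: le_integrableR iA|apply: le_integrableR iA] => // x;
    [exact: Re_le_cabs|exact: Im_le_cabs].
apply: (@le_integrableR _ _ _ _ _ (fun x => `|Re (f x)| + `|Im (f x)|)).
- exact: measurable_cabs.
- by move=> x; rewrite ger0_norm ?cabs_ge0// cabs_le.
- rewrite /comp; under eq_fun do rewrite EFinD.
  by apply: integrableD => //; exact: (@integrable_norm _ _ _ mu setT).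
Qed.

Lemma le_cintegrable f (h : Rn -> R) : cmeasurable f ->
  (forall x, cabs (f x) <= h x) -> mu.-integrable setT (EFin \o h) ->
  cintegrable f.
Proof.
move=> mf fh ih; apply/(integrable_cabs mf).
apply: le_integrableR ih; first exact: measurable_cabs.
by move=> x; rewrite ger0_norm ?cabs_ge0.
Qed.

Lemma integrable_oneDsqrV :
  (@lebesgue_measure R).-integrable setT (EFin \o (fun t : R => (1 + t ^+ 2)^-1)).
Proof.
have c : continuous (fun t : R => (1 + t ^+ 2)^-1) by exact: continuous_oneDsqrV.
apply/integrableP; split.
  by apply/measurable_EFinP; apply: continuous_measurable_fun.
have p t : 0 <= (1 + t ^+ 2)^-1 :> R by rewrite invr_ge0 addr_ge0// sqr_ge0.
under eq_integral do rewrite /= ger0_norm//.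
rewrite ge0_symfun_integralT//; last by move=> t /=; rewrite sqrrN.
rewrite -set_itvcy integral0y_oneDsqr; exact: ltry.
Qed.

(** The weight of exponent n suffices: (1 + |x|^2)^(-n) is at most the product of the (1 +
    x_i^2)^(-1), which is integrable coordinate by coordinate. *)
Lemma schwartz_integrable psi : schwartz psi -> cintegrable psi.
Proof.
move=> spsi; have [_ /(_ n)[M hM]] := spsi.
have p (t : R) : 0 <= (1 + t ^+ 2)^-1 :> R by rewrite invr_ge0 addr_ge0// sqr_ge0.
apply: (@le_cintegrable _ (fun x => M * \prod_i (1 + x 0 i ^+ 2)^-1)).
- exact: schwartz_measurable.
- move=> x; have := hM [::] isT x.
  rewrite (_ : cpartial [::] psi x = psi x); last by rewrite /cpartial /=; case: (psi x).
  rewrite mulrC -ler_pdivlMr ?exprn_gt0 ?ltr_wpDr ?sqnorm_ge0// => /le_trans; apply.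
  have M0 : 0 <= M.
    apply: le_trans (hM [::] isT x); rewrite mulr_ge0 ?cabs_ge0// exprn_ge0//.
    by rewrite addr_ge0// sqnorm_ge0.
  rewrite ler_wpM2l// -exprVn -[X in _ ^+ X]card_ord -prodr_const ler_prod// => i _.
  rewrite invr_ge0 addr_ge0 ?sqnorm_ge0//= lef_pV2 ?posrE ?ltr_wpDr ?sqr_ge0 ?sqnorm_ge0//.
  by rewrite lerD2l sqr_coord_le.
- rewrite /comp; under eq_fun do rewrite EFinM.
  apply: integrableZl => //.
  have ii := integrable_oneDsqrV.
  apply: (@integrable_prod_coord R n (fun _ t => (1 + t ^+ 2)^-1)
    (fun=> \int[@lebesgue_measure R]_t (1 + t ^+ 2)^-1)) => [i|//|i].
    by apply/measurable_EFinP; case/integrableP: ii.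
  by rewrite /Rintegral fineK//; exact: integrable_fin_num ii.
Qed.

End Schwartz.

(** * The multiplication formula *)

Section FourierTransform.
Variables (R : realType) (n : nat).
Local Notation Rn := 'rV[R]_n.
Local Notation C := R[i].
Local Notation mu := (lebesgue_rV R n).
Local Notation Re := (@complex.Re R).
Local Notation Im := (@complex.Im R).
Implicit Types (f g psi : Rn -> C) (x y c : Rn) (z : C).

Lemma cmeasurableM f g : cmeasurable f -> cmeasurable g ->
  cmeasurable (fun x => f x * g x).
Proof.
move=> [fR fI] [gR gI]; split.
  by under eq_fun do rewrite cReM; apply: measurable_funB; exact: measurable_funM.
by under eq_fun do rewrite cImM; apply: measurable_funD; exact: measurable_funM.
Qed.

Lemma cmeasurable_cis y : cmeasurable (fun x => cis (- dot x y)).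
Proof.
by split => /=; apply: continuous_measurable_rV => x;
  apply: continuous_comp; rewrite ?oppr0;
  [exact: (cvgN (@continuous_dot _ _ y x))|exact: continuous_cos
  |exact: (cvgN (@continuous_dot _ _ y x))|exact: continuous_sin].
Qed.

Lemma cintegrable_mul_bounded f g M : cmeasurable f -> cintegrable f ->
  cmeasurable g -> (forall x, cabs (g x) <= M) ->
  cintegrable (fun x => f x * g x).
Proof.
move=> mf intf mg gM.
apply: (@le_cintegrable _ _ _ (fun x => M * cabs (f x))).
- exact: cmeasurableM.
- by move=> x; rewrite cabsM mulrC ler_wpM2r ?cabs_ge0.
- rewrite /comp; under eq_fun do rewrite EFinM.
  by apply: integrableZl => //; apply/(integrable_cabs mf).
Qed.

Lemma cintegrableZ z f : cintegrable f -> cintegrable (fun x => z * f x).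
Proof.
move=> [fR fI].
have iZ (a : R) (h : Rn -> R) : mu.-integrable setT (EFin \o h) ->
    mu.-integrable setT (EFin \o (fun x => a * h x)).
  by move=> ih; rewrite /comp; under eq_fun do rewrite EFinM; exact: integrableZl.
split; rewrite /comp.
  under eq_fun do rewrite cReM EFinB.
  by apply: integrableB => //; exact: iZ.
under eq_fun do rewrite cImM EFinD.
by apply: integrableD => //; exact: iZ.
Qed.

Lemma cintegralZ z f : cintegrable f -> cintegral (fun x => z * f x) = z * cintegral f.
Proof.
move=> [fR fI].
have iZ (a : R) (h : Rn -> R) : mu.-integrable setT (EFin \o h) ->
    mu.-integrable setT (EFin \o (fun x => a * h x)).
  by move=> ih; rewrite /comp; under eq_fun do rewrite EFinM; exact: integrableZl.
rewrite /cintegral; apply: ceqP => /=.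
  under eq_Rintegral do rewrite cReM.
  by rewrite RintegralB ?iZ// !RintegralZl// cReM.
under eq_Rintegral do rewrite cImM.
by rewrite RintegralD ?iZ// !RintegralZl// cImM.
Qed.

Lemma cintegralD f g : cintegrable f -> cintegrable g ->
  cintegral (fun x => f x + g x) = cintegral f + cintegral g.
Proof.
move=> [fR fI] [gR gI].
rewrite /cintegral; apply: ceqP => /=.
  transitivity (\int[mu]_x (Re (f x) + Re (g x))); last by rewrite RintegralD.
  by apply: eq_Rintegral => x _; case: (f x) (g x) => [? ?] [].
transitivity (\int[mu]_x (Im (f x) + Im (g x))); last by rewrite RintegralD.
by apply: eq_Rintegral => x _; case: (f x) (g x) => [? ?] [].
Qed.

(** The factor 2 comes from treating real and imaginary parts separately; it is harmless, as the
    bound serves only to show temperedness. *)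
Lemma cabs_cintegral_le f : cmeasurable f -> cintegrable f ->
  cabs (cintegral f) <= 2 * \int[mu]_x cabs (f x).
Proof.
move=> mf intf; have [fR fI] := intf; have iA := (integrable_cabs mf).1 intf.
apply: le_trans (cabs_le _) _ => /=.
rewrite mulr2n mulrDl mul1r lerD//.
  apply: le_trans (le_normr_Rintegral measurableT fR) _.
  apply: le_Rintegral => //; first exact: (@integrable_norm _ _ _ mu setT).
  by move=> x _; exact: Re_le_cabs.
apply: le_trans (le_normr_Rintegral measurableT fI) _.
apply: le_Rintegral => //; first exact: (@integrable_norm _ _ _ mu setT).
by move=> x _; exact: Im_le_cabs.
Qed.

Lemma measurable_dot2 : measurable_fun setT (fun w : Rn * Rn => dot w.1 w.2).
Proof.
rewrite /dot; apply: measurable_sum => i.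
apply: measurable_funM.
  apply: (@measurableT_comp _ _ _ _ _ _ (fun x : Rn => x 0 i)) => //.
  exact: measurable_coord.
apply: (@measurableT_comp _ _ _ _ _ _ (fun x : Rn => x 0 i)) => //.
exact: measurable_coord.
Qed.

Section mult.
Variables f g : Rn -> C.
Hypotheses (mf : cmeasurable f) (intf : cintegrable f).
Hypotheses (mg : cmeasurable g) (intg : cintegrable g).

Let H (w : Rn * Rn) : C := f w.1 * (g w.2 * cis (- dot w.1 w.2)).

Let mH : measurable_fun setT (Re \o H) /\ measurable_fun setT (Im \o H).
Proof.
have md : measurable_fun setT (fun w : Rn * Rn => - dot w.1 w.2).
  by apply: measurableT_comp => //; exact: measurable_dot2.
have mc : measurable_fun setT (fun w : Rn * Rn => cos (- dot w.1 w.2)).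
  apply: (@measurableT_comp _ _ _ _ _ _ (@cos R)) => //.
  by apply: continuous_measurable_fun; exact: continuous_cos.
have ms : measurable_fun setT (fun w : Rn * Rn => sin (- dot w.1 w.2)).
  apply: (@measurableT_comp _ _ _ _ _ _ (@sin R)) => //.
  by apply: continuous_measurable_fun; exact: continuous_sin.
have [fR fI] := mf; have [gR gI] := mg.
have fR' : measurable_fun setT (fun w : Rn * Rn => Re (f w.1)).
  exact: (measurableT_comp fR).
have fI' : measurable_fun setT (fun w : Rn * Rn => Im (f w.1)).
  exact: (measurableT_comp fI).
have gR' : measurable_fun setT (fun w : Rn * Rn => Re (g w.2)).
  exact: (measurableT_comp gR).
have gI' : measurable_fun setT (fun w : Rn * Rn => Im (g w.2)).
  exact: (measurableT_comp gI).
split; rewrite /comp /H.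
  under eq_fun do rewrite !(cReM, cImM) /=.
  by repeat first [assumption|apply: measurable_funM|apply: measurable_funB|apply: measurable_funD].
under eq_fun do rewrite !(cReM, cImM) /=.
by repeat first [assumption|apply: measurable_funM|apply: measurable_funB|apply: measurable_funD].
Qed.

Let intH : (mu \x mu)%E.-integrable setT (EFin \o (Re \o H)) /\
  (mu \x mu)%E.-integrable setT (EFin \o (Im \o H)).
Proof.
have mA := measurable_cabs mf; have mB := measurable_cabs mg.
have iA := (integrable_cabs mf).1 intf; have iB := (integrable_cabs mg).1 intg.
have mAB : measurable_fun setT (fun w : Rn * Rn => cabs (f w.1) * cabs (g w.2)).
  by apply: measurable_funM; [exact: (measurableT_comp mA)|exact: (measurableT_comp mB)].
have iAB : (mu \x mu)%E.-integrable setT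
    (EFin \o (fun w : Rn * Rn => cabs (f w.1) * cabs (g w.2))).
  apply/integrable12ltyP; first exact/measurable_EFinP.
  under eq_integral => x _.
    under eq_integral do rewrite /= ger0_norm ?mulr_ge0 ?cabs_ge0// EFinM.
    rewrite integralZl//; over.
  rewrite -(fineK (integrable_fin_num measurableT iB)) integralZr//.
  by rewrite -(fineK (integrable_fin_num measurableT iA)) -EFinM ltry.
have b w : cabs (H w) = cabs (f w.1) * cabs (g w.2).
  by rewrite /H !cabsM cabs_cis mulr1.
by split; apply: le_integrableR iAB; [exact: mH.1| |exact: mH.2|] => w;
  rewrite -b; [exact: Re_le_cabs|exact: Im_le_cabs].
Qed.

Let i1 x : cintegrable (fun y => g y * cis (- dot x y)).
Proof.
apply: (@cintegrable_mul_bounded _ _ 1) => // [|y]; last by rewrite cabs_cis.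
by under eq_fun do rewrite dotC; exact: cmeasurable_cis.
Qed.

Let i2 y : cintegrable (fun x => f x * cis (- dot x y)).
Proof.
apply: (@cintegrable_mul_bounded _ _ 1) => // [|x]; last by rewrite cabs_cis.
exact: cmeasurable_cis.
Qed.

Let HE y : (fun x => H (x, y)) = (fun x => g y * (f x * cis (- dot x y))).
Proof. by apply/funext => x; rewrite /H /= mulrCA. Qed.

Let slice1 x : f x * fourier g x = cintegral (fun y => H (x, y)).
Proof.
rewrite /H /= cintegralZ//.
by congr (_ * cintegral _); apply/funext => y; rewrite dotC.
Qed.

Let slice2 y : fourier f y * g y = cintegral (fun x => H (x, y)).
Proof. by rewrite HE cintegralZ// mulrC. Qed.

(** Fubini for [H], whose modulus is |f(x)| |g(y)|. The formula is what identifies the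
    distributional transform of a Schwartz function with its classical transform. *)
Lemma fourier_mult : [/\ cintegrable (fun x => f x * fourier g x),
  cintegrable (fun y => fourier f y * g y) &
  cintegral (fun x => f x * fourier g x) = cintegral (fun y => fourier f y * g y)].
Proof.
have [iR iI] := intH.
have F1 (h : Rn * Rn -> R) : (mu \x mu)%E.-integrable setT (EFin \o h) ->
    (forall x, mu.-integrable setT (EFin \o (fun y => h (x, y)))) ->
    mu.-integrable setT (EFin \o (fun x => \int[mu]_y h (x, y))) /\
    \int[mu]_x (\int[mu]_y h (x, y)) = fine (\int[(mu \x mu)%E]_w (h w)%:E).
  move=> ih hx.
  have E : EFin \o (fun x => \int[mu]_y h (x, y)) = fubini_F mu (EFin \o h).
    apply/funext => x; rewrite /= /Rintegral fineK//.
    exact: integrable_fin_num (hx x).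
  split; first by rewrite E; exact: integrable_fubini_F.
  by rewrite -(integral12_prod_meas1 ih) -E.
have F2 (h : Rn * Rn -> R) : (mu \x mu)%E.-integrable setT (EFin \o h) ->
    (forall y, mu.-integrable setT (EFin \o (fun x => h (x, y)))) ->
    mu.-integrable setT (EFin \o (fun y => \int[mu]_x h (x, y))) /\
    \int[mu]_y (\int[mu]_x h (x, y)) = fine (\int[(mu \x mu)%E]_w (h w)%:E).
  move=> ih hy.
  have E : EFin \o (fun y => \int[mu]_x h (x, y)) = fubini_G mu (EFin \o h).
    apply/funext => y; rewrite /= /Rintegral fineK//.
    exact: integrable_fin_num (hy y).
  (* The outer integrand is dominated by the integral of |h| over the first variable, which has
     finite integral by Tonelli. *)
  split.
    have mh := measurable_int _ ih.
    have mah : measurable_fun setT (abse \o (EFin \o h)) by exact: measurableT_comp.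
    rewrite E; apply/integrableP; split; first exact: (measurable_fubini_G ih).
    have lt := (integrable21ltyP mu mu mh).1 ih; apply: (le_lt_trans _ lt).
    apply: ge0_le_integral => //.
    - by apply: measurableT_comp => //; exact: (measurable_fubini_G ih).
    - by apply: (measurable_fun_fubini_tonelli_G (abse \o (EFin \o h))) => // w; exact: abse_ge0.
    - move=> y _; apply: le_abse_integral => //.
      exact: (measurable_int mu (hy y)).
  by rewrite -(integral21_prod_meas1 ih) -E.
have j1 x : cintegrable (fun y => H (x, y)) by exact: (cintegrableZ (f x) (i1 x)).
have j2 y : cintegrable (fun x => H (x, y)) by rewrite HE; exact: (cintegrableZ (g y) (i2 y)).
have [a1 b1] := F1 _ iR (fun x => (j1 x).1).
have [a2 b2] := F1 _ iI (fun x => (j1 x).2).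
have [c1 d1] := F2 _ iR (fun x => (j2 x).1).
have [c2 d2] := F2 _ iI (fun x => (j2 x).2).
rewrite (_ : (fun x => f x * _) = (fun x => cintegral (fun y => H (x, y)))); last exact/funext/slice1.
rewrite (_ : (fun y => _ * g y) = (fun y => cintegral (fun x => H (x, y)))); last exact/funext/slice2.
split; [by split|by split|].
by apply: ceqP; [exact: (etrans b1 (esym d1))|exact: (etrans b2 (esym d2))].
Qed.

End mult.

End FourierTransform.

(** * Fourier transforms and norms of wave packets *)

Section Packets.
Variables (R : realType) (n : nat).
Local Notation Rn := 'rV[R]_n.
Local Notation C := R[i].
Local Notation mu := (lebesgue_rV R n).
Local Notation Re := (@complex.Re R).
Local Notation Im := (@complex.Im R).
Implicit Types (f g psi phi : Rn -> C) (x y c xi : Rn) (z : C).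

Definition dist phi (psi : Rn -> C) : C := cintegral (fun x => phi x * psi x).

Lemma schwartz_mul_integrable phi psi : schwartz phi -> schwartz psi ->
  cintegrable (fun x => phi x * psi x).
Proof.
move=> sphi spsi; have [M hM] := schwartz_bounded spsi.
apply: cintegrable_mul_bounded hM; first exact: schwartz_measurable.
  exact: schwartz_integrable.
exact: schwartz_measurable.
Qed.

Lemma tempered_dist phi : schwartz phi -> tempered (dist phi).
Proof.
move=> sphi; split=> [z psi1 psi2 s1 s2|].
  rewrite /dist -cintegralZ; last exact: schwartz_mul_integrable.
  rewrite -cintegralD; last 2 first.
  - by apply: cintegrableZ; exact: schwartz_mul_integrable.
  - exact: schwartz_mul_integrable.
  by congr cintegral; apply/funext => x; rewrite mulrDr mulrCA.
have mphi := schwartz_measurable sphi.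
have iphi := (integrable_cabs mphi).1 (schwartz_integrable sphi).
(* Order 0 is enough: the supremum of psi against the L^1 norm of phi. *)
exists 0%N, (2 * \int[mu]_x cabs (phi x)) => psi M spsi hM.
have b x : cabs (psi x) <= M.
  have := hM [::] isT x; rewrite expr0 mul1r; congr (cabs _ <= _).
  by rewrite /cpartial /=; case: (psi x).
have ipp := schwartz_mul_integrable sphi spsi.
have mpp := cmeasurableM mphi (schwartz_measurable spsi).
apply: le_trans (cabs_cintegral_le mpp ipp) _.
rewrite -mulrA ler_pM2l// -RintegralZr//; apply: le_Rintegral => //.
- exact: (integrable_cabs mpp).1.
- by rewrite /comp; under eq_fun do rewrite EFinM; exact: integrableZr.
- by move=> x _; rewrite cabsM ler_wpM2l ?cabs_ge0.
Qed.

Lemma is_function_dist phi : schwartz phi -> is_function (dist phi) phi.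
Proof.
move=> sphi; split; first exact: schwartz_measurable.
by move=> psi spsi; split=> //; exact: schwartz_mul_integrable.
Qed.

Lemma is_function_dfourier phi : schwartz phi -> cmeasurable (fourier phi) ->
  is_function (dfourier (dist phi)) (fourier phi).
Proof.
move=> sphi mF; split=> // psi spsi.
have [] := fourier_mult (schwartz_measurable sphi) (schwartz_integrable sphi)
  (schwartz_measurable spsi) (schwartz_integrable spsi).
by move=> _ i1 e; split => //; rewrite /dfourier /dist e.
Qed.

Section packet.
Variables (sigma : 'I_n -> R) (sigma_gt0 : forall i, 0 < sigma i) (c : Rn).

Let sigma0 i : sigma i != 0. Proof. by rewrite gt_eqF. Qed.

(** Up to the factor (2 pi)^n this is the transform of the packet. As a probability density it makes
    [T_schwartz] of the packet the expectation of a unimodular function. *)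
Definition density xi : R := \prod_i normal_pdf (c 0 i) (sigma i) (xi 0 i).

Lemma density_ge0 xi : 0 <= density xi.
Proof. by rewrite prodr_ge0// => i _; exact: normal_pdf_ge0. Qed.

Lemma measurable_density : measurable_fun setT density.
Proof.
apply: (measurable_prod_coord (f := fun i => normal_pdf (c 0 i) (sigma i))) => i.
exact: measurable_normal_pdf.
Qed.

Lemma integral_density : (\int[mu]_xi (density xi)%:E = 1)%E.
Proof.
rewrite /density (@integral_prod_coord R n (fun i => normal_pdf (c 0 i) (sigma i)) (fun=> 1)).
- by rewrite prodr_const expr1n.
- by move=> i; exact: measurable_normal_pdf.
- by move=> i x; exact: normal_pdf_ge0.
- by move=> i; exact: integral_normal_pdf.
Qed.

Lemma integrable_density : mu.-integrable setT (EFin \o density).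
Proof.
apply/integrableP; split; first by apply/measurable_EFinP; exact: measurable_density.
under eq_integral do rewrite /= ger0_norm ?density_ge0//.
by rewrite integral_density ltry.
Qed.

Lemma fourier_packet xi :
  fourier (packet sigma c) xi = (((2 * pi) ^+ n * density xi)%:C)%C.
Proof.
have D : (2 * pi) ^+ n * density xi =
    \prod_i (2 * pi * normal_pdf 0 (sigma i) ((xi - c) 0 i)).
  rewrite big_split /= prodr_const card_ord; congr (_ * _).
  apply: eq_bigr => i _; rewrite !normal_pdfE// !mxE.
  by rewrite /normal_fun subr0.
have dB x : dot x (xi - c) = dot x xi - dot x c.
  by rewrite /dot -sumrB; apply: eq_bigr => i _; rewrite !mxE mulrBr.
rewrite D /fourier /cintegral; apply: ceqP => /=.
  have := congr1 fine (fourier_gauss_rV (xi - c) 0 sigma_gt0).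
  rewrite cos0 mulr1 /= => <-.
  congr fine; apply: eq_integral => x _; rewrite addr0 dB cosB cosN sinN.
  by rewrite /prod_gauss; congr EFin; ring.
(* Since cos(u + pi / 2) = - sin u, the phase pi / 2 yields the imaginary part, which vanishes. *)
have := congr1 fine (fourier_gauss_rV (xi - c) (pi / 2) sigma_gt0).
rewrite cos_pihalf mulr0 /= => <-.
congr fine; apply: eq_integral => x _.
rewrite cosDpihalf dB sinB cosN sinN.
by rewrite /prod_gauss; congr EFin; ring.
Qed.

(** The standardised frequency: in this variable the packets have the same profile whatever their
    widths and centre. *)
Definition normalized xi : Rn := \row_i ((xi 0 i - c 0 i) / sigma i).

End packet.

Lemma measurable_normalized (m : nat) (sigma : 'I_n -> R) c : measurable_fun setT
  (fun xi => (1 + sqnorm (normalized sigma c xi)) ^+ m * density sigma c xi).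
Proof.
apply/measurable_funM; last exact: measurable_density.
apply: measurable_funX; apply: measurable_funD => //.
apply: measurable_sum => i; rewrite /normalized; under eq_fun do rewrite mxE.
apply: (measurable_coord_comp i
  (g := fun t : R => (t - c 0 i) / sigma i * ((t - c 0 i) / sigma i))).
by apply: continuous_measurable_fun => t; apply: cvgM; apply: cvgM;
  [apply: cvgB; [exact: cvg_id|exact: cvg_cst]|exact: cvg_cst
  |apply: cvgB; [exact: cvg_id|exact: cvg_cst]|exact: cvg_cst].
Qed.

(** A Gaussian absorbs a polynomial weight at the price of doubling its width. The constant depends
    on m alone, so nothing is lost as L grows. *)
Lemma normal_pdf_moment (m : nat) : exists2 M : R, 0 <= M &
  forall a sigma t : R, 0 < sigma ->
  (1 + ((t - a) / sigma) ^+ 2) ^+ m * normal_pdf a sigma t <=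
  M * normal_pdf a (2 * sigma) t.
Proof.
have h0 : 2^-1 != 0 :> R by rewrite invr_eq0.
have [M hM] := gauss_decay m h0.
exists (2 * M).
  have := hM 0; rewrite expr0n /= addr0 expr1n mul1r => /(le_trans (ltW (gauss_gt0 _ _))) M0.
  by rewrite mulr_ge0.
move=> a s t s0; have s20 : 0 < 2 * s by rewrite mulr_gt0.
rewrite !normal_pdfE ?gt_eqF// !normal_peakE//.
set y := (t - a) / s.
have -> : normal_fun a (2 * s) t = gauss 2^-1 y.
  by rewrite /normal_fun /gauss /y -mulr_natr; congr expR; field; rewrite gt_eqF.
(* Of the two factors exp(- y^2 / 8), one absorbs the weight and the other is the profile of width 2
   s. *)
have e1 : normal_fun a s t <= gauss 2^-1 y * gauss 2^-1 y.
  rewrite /normal_fun /gauss -expRD ler_expR.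
  have -> : - (t - a) ^+ 2 / (s ^+ 2 *+ 2) = - (y ^+ 2 / 2).
    by rewrite /y -mulr_natr; field; rewrite gt_eqF.
  by have := sqr_ge0 y; lra.
have p0 : 0 < Num.sqrt (pi *+ 2) :> R by rewrite sqrtr_gt0 pmulrn_lgt0// pi_gt0.
set p := Num.sqrt _ in p0 *.
have g0 := gauss_gt0 2^-1 y.
have u0 : 0 <= (1 + y ^+ 2) ^+ m by rewrite exprn_ge0// addr_ge0// sqr_ge0.
apply: le_trans (_ : (s * p)^-1 * ((1 + y ^+ 2) ^+ m * gauss 2^-1 y * gauss 2^-1 y) <= _).
  rewrite mulrCA ler_wpM2l ?invr_ge0 ?mulr_ge0 ?(ltW s0) ?(ltW p0)//.
  by rewrite -mulrA ler_wpM2l.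
rewrite (_ : 2 * M * ((2 * s * p)^-1 * gauss 2^-1 y) = (s * p)^-1 * (M * gauss 2^-1 y)); last first.
  by field; rewrite !gt_eqF.
rewrite ler_wpM2l ?invr_ge0 ?mulr_ge0 ?(ltW s0) ?(ltW p0)//.
by rewrite ler_pM2r.
Qed.

(** The weighted density is dominated by a constant times the density of doubled widths, which has
    mass 1. The order of quantifiers matters: the bound precedes the widths and the centre. *)
Lemma density_moment (m : nat) : exists2 M : R, 0 <= M &
  forall (sigma : 'I_n -> R) (c : Rn), (forall i, 0 < sigma i) ->
  (\int[mu]_xi ((1 + sqnorm (normalized sigma c xi)) ^+ m * density sigma c xi)%:E <= M%:E)%E.
Proof.
have [M M0 hM] := normal_pdf_moment m.
exists (M ^+ n); first exact: exprn_ge0.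
move=> sigma c s0.
have X0 x : 0 <= (1 + sqnorm x) by rewrite addr_ge0// sqnorm_ge0.
apply: le_trans (_ : (\int[mu]_xi (M ^+ n * density (fun i => 2 * sigma i)%R c xi)%:E <= _)%E); last first.
  under eq_integral do rewrite EFinM.
  rewrite ge0_integralZl//.
  - by rewrite integral_density mule1.
  - by apply/measurable_EFinP; exact: measurable_density.
  - by move=> x _; rewrite lee_fin density_ge0.
  - by rewrite lee_fin exprn_ge0.
apply: ge0_le_integral => //.
- by move=> x _; rewrite lee_fin mulr_ge0 ?density_ge0 ?exprn_ge0.
- by apply/measurable_EFinP; exact: measurable_normalized.
- by apply/measurable_EFinP/measurable_funM => //; exact: measurable_density.
- move=> x _; rewrite lee_fin -[n in M ^+ n]card_ord -prodr_const.
  rewrite /density -big_split /=.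
  apply: le_trans (_ : \prod_i ((1 + (normalized sigma c x) 0 i ^+ 2) ^+ m * normal_pdf (c 0 i) (sigma i) (x 0 i)) <= _).
    rewrite big_split /= ler_wpM2r ?prodr_ge0//.
      by move=> i _; exact: normal_pdf_ge0.
    by rewrite prodrXl lerXn2r ?nnegrE ?X0 ?(le_trans (X0 _) (sqnorm_prod_le _)) ?sqnorm_prod_le.
  apply: ler_prod => i _; rewrite mulr_ge0 ?normal_pdf_ge0 ?exprn_ge0 ?addr_ge0 ?sqr_ge0//=.
  by rewrite mxE hM.
Qed.

Lemma cos_ge_1B (u : R) : 1 - `|u| <= cos u.
Proof.
wlog u0 : u / 0 <= u => [H|].
  by case: (leP 0 u) => [/H//|u0]; rewrite -normrN -cosN H// oppr_ge0 ltW.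
have dc (x : R) : x \in `]0, u[ -> is_derive x 1 (@cos R) (- sin x).
  by move=> _; exact: is_derive_cos.
have [z _] := MVT_segment u0 dc (continuous_subspaceT (@continuous_cos R)).
rewrite cos0 subr0 ger0_norm// => E.
by have := sin_le1 z; nra.
Qed.

Lemma measurable_peval (P : {mpoly R[n]}) : measurable_fun setT (peval P).
Proof.
rewrite /peval; under eq_fun do rewrite mpoly.mevalE.
apply: measurable_sum => m; apply: measurable_funM => //.
apply: measurable_prod => i _; apply: measurable_funX; exact: measurable_coord.
Qed.

(** Rotating by exp(-i th) and taking real parts bounds the modulus below by the mean of cos(phase -
    th). As cos u >= 1 - |u|, this mean is at least 1 - b M. The phase error may thus be large in
    the tails. *)
Lemma T_packet_lower (P : {mpoly R[n]}) (t th b M : R) (m : nat)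
    (sigma : 'I_n -> R) c x : (forall i, 0 < sigma i) ->
  0 <= b -> b * M <= 2^-1 ->
  (\int[mu]_xi ((1 + sqnorm (normalized sigma c xi)) ^+ m * density sigma c xi)%:E <= M%:E)%E ->
  (forall xi, `|dot x xi + peval P xi * t - th| <=
     b * (1 + sqnorm (normalized sigma c xi)) ^+ m) ->
  2^-1 <= cabs (T_schwartz P t (packet sigma c) x).
Proof.
move=> s0 b0 bM hM hth.
pose theta xi := dot x xi + peval P xi * t.
pose D := density sigma c.
pose w xi : C := ((D xi)%:C)%C * cis (theta xi).
pose G xi := (1 + sqnorm (normalized sigma c xi)) ^+ m * D xi.
have mG : measurable_fun setT G by exact: measurable_normalized.
have G0 xi : 0 <= G xi.
  by rewrite mulr_ge0 ?density_ge0// exprn_ge0// addr_ge0// sqnorm_ge0.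
have iG : mu.-integrable setT (EFin \o G).
  apply/integrableP; split; first exact/measurable_EFinP.
  under eq_integral do rewrite /= ger0_norm//.
  exact: le_lt_trans hM (ltry _).
have mtheta : measurable_fun setT theta.
  apply: measurable_funD; last by apply: measurable_funM => //; exact: measurable_peval.
  rewrite (_ : dot x = (fun xi => dot xi x)).
    by apply: continuous_measurable_rV; exact: continuous_dot.
  by apply/funext => xi; rewrite dotC.
have mcis : cmeasurable (fun xi => cis (theta xi)).
  by split => /=; [apply: (@measurableT_comp _ _ _ _ _ _ (@cos R)) => //
    |apply: (@measurableT_comp _ _ _ _ _ _ (@sin R)) => //];
    apply: continuous_measurable_fun; [exact: continuous_cos|exact: continuous_sin].
have mD : cmeasurable (fun xi => ((D xi)%:C)%C).
  by split => //=; exact: measurable_density.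
have iD : cintegrable (fun xi => ((D xi)%:C)%C).
  by split => /=; [exact: integrable_density|exact: integrable0].
have iw : cintegrable w.
  by apply: (@cintegrable_mul_bounded _ _ _ _ 1) => // xi; rewrite cabs_cis.
have -> : T_schwartz P t (packet sigma c) x = cintegral w.
  rewrite /T_schwartz -cintegralZ.
    congr cintegral; apply/funext => xi; rewrite fourier_packet// mulrA; congr (_ * _).
    rewrite -rmorphM/= mulrA mulVf ?mul1r// expf_neq0// mulf_neq0//.
    by rewrite gt_eqF// pi_gt0.
  rewrite (_ : (fun xi => _) = (fun xi => (((2 * pi) ^+ n)%:C)%C * w xi)).
    exact: cintegrableZ.
  by apply/funext => xi; rewrite fourier_packet// rmorphM/= mulrA.
have -> : cabs (cintegral w) = cabs (cis (- th) * cintegral w).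
  by rewrite cabsM cabs_cis mul1r.
rewrite -cintegralZ//.
have [iR _] := cintegrableZ (cis (- th)) iw.
apply: le_trans (Re_le_cabs _); apply: le_trans (ler_norm _).
rewrite /cintegral /=.
have iDb : mu.-integrable setT (EFin \o (fun xi => D xi - b * G xi)).
  rewrite /comp; under eq_fun do rewrite EFinB EFinM.
  apply: integrableB => //; first exact: integrable_density.
  exact: integrableZl.
apply: le_trans (_ : \int[mu]_xi (D xi - b * G xi) <= _).
  rewrite RintegralB//; last 2 first.
  - exact: integrable_density.
  - by rewrite /comp; under eq_fun do rewrite EFinM; exact: integrableZl.
  rewrite RintegralZl// {1}/Rintegral integral_density//=.
  have : \int[mu]_x G x <= M.
    rewrite -lee_fin /Rintegral fineK//; exact: integrable_fin_num iG.
  by move=> GM; have := ler_wpM2l b0 GM; lra.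
apply: le_Rintegral => // xi _.
rewrite [leRHS](_ : _ = D xi * cos (theta xi - th)); last first.
  by rewrite cosB cosN sinN; ring.
have := cos_ge_1B (theta xi - th); have := hth xi; rewrite -/(theta xi) => h1 h2.
have D0 : 0 <= D xi by exact: density_ge0.
have h3 : 1 - b * (1 + sqnorm (normalized sigma c xi)) ^+ m <= cos (theta xi - th) by lra.
by have := ler_wpM2l D0 h3; rewrite /G mulrBr mulr1 mulrCA (mulrC (D xi) (_ ^+ m)).
Qed.

Lemma normal_pdf_le_peak (a s u : R) : 0 < s -> normal_pdf a s u <= normal_peak s.
Proof. by move=> s0; apply: normal_pdf_ub; rewrite gt_eqF. Qed.

(** One of the two factors in |fhat|^2 is bounded by the peak of the density, which is small for
    wide packets; the other stays as a probability density against which the weight is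
    integrated. *)
Lemma sobolev_packet_le (s A M : R) (m : nat) (sigma : 'I_n -> R) c :
  (forall i, 0 < sigma i) ->
  (\int[mu]_xi ((1 + sqnorm (normalized sigma c xi)) ^+ m * density sigma c xi)%:E <= M%:E)%E ->
  0 <= A ->
  (forall xi, (1 + sqnorm xi) `^ s <= A * (1 + sqnorm (normalized sigma c xi)) ^+ m) ->
  (sobolev_sqnorm s (fourier (packet sigma c)) <=
    ((2 * pi) ^+ n * (\prod_i normal_peak (sigma i)) * A * M)%:E)%E.
Proof.
move=> s0 hM A0 hA; rewrite /sobolev_sqnorm.
pose p := \prod_i normal_peak (sigma i).
have p0 : 0 <= p by rewrite prodr_ge0// => i _; exact: normal_peak_ge0.
pose D := density sigma c; have D0 xi : 0 <= D xi by exact: density_ge0.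
have Dp xi : D xi <= p.
  by apply: ler_prod => i _; rewrite normal_pdf_ge0 normal_pdf_le_peak.
pose q : R := (2 * pi) ^+ n; have q0 : 0 < q by rewrite exprn_gt0// mulr_gt0// pi_gt0.
pose G xi := (1 + sqnorm (normalized sigma c xi)) ^+ m * D xi.
have mG : measurable_fun setT G by exact: measurable_normalized.
have G0 xi : 0 <= G xi.
  by rewrite mulr_ge0// exprn_ge0// addr_ge0// sqnorm_ge0.
apply: le_trans (_ : (q^-1)%:E * \int[mu]_xi ((q ^+ 2 * p * A)%:E * (G xi)%:E) <= _)%E.
  rewrite lee_wpmul2l ?lee_fin ?invr_ge0 ?(ltW q0)//.
  apply: ge0_le_integral => //.
  - by move=> xi _; rewrite lee_fin mulr_ge0 ?powR_ge0// exprn_ge0// cabs_ge0.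
  - apply/measurable_EFinP/measurable_funM.
      apply: (@measurableT_comp _ _ _ _ _ _ (fun u => u `^ s)).
        exact: measurable_powR.
      apply: measurable_funD => //; apply: measurable_sum => i.
      by apply: measurable_funM; exact: measurable_coord.
    apply: measurable_funX; apply: measurable_cabs.
    rewrite (_ : fourier _ = (fun xi => ((q * D xi)%:C)%C)).
      by split => //=; apply: measurable_funM => //; exact: measurable_density.
    by apply/funext => xi; rewrite fourier_packet.
  - by apply/measurable_EFinP/measurable_funM.
  - move=> xi _; rewrite fourier_packet// -/q -/D -EFinM lee_fin.
    rewrite /cabs /= expr0n addr0 sqrtr_sqr real_normK ?num_real//.
    rewrite exprMn /G.
    have -> : q ^+ 2 * p * A * ((1 + sqnorm (normalized sigma c xi)) ^+ m * D xi) =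
      A * (1 + sqnorm (normalized sigma c xi)) ^+ m * (q ^+ 2 * (p * D xi)) by ring.
    apply: ler_pM => //; first exact: powR_ge0.
      by rewrite mulr_ge0// exprn_ge0// ltW.
    have q20 : 0 <= q ^+ 2 by rewrite exprn_ge0// ltW.
    by rewrite (ler_wpM2l q20)// expr2 ler_wpM2r.
rewrite ge0_integralZl//; last 3 first.
- exact/measurable_EFinP.
- by move=> xi _; rewrite lee_fin.
- by rewrite lee_fin (mulr_ge0 (mulr_ge0 _ p0) A0)// exprn_ge0// ltW.
rewrite muleA -EFinM.
have -> : q^-1 * (q ^+ 2 * p * A) = q * p * A by field; rewrite gt_eqF.
rewrite -/q -/p [leRHS]EFinM; apply: lee_wpmul2l => //.
by rewrite lee_fin (mulr_ge0 (mulr_ge0 (ltW q0) p0) A0).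
Qed.

End Packets.

(** * Growth of polynomials along a family of frequencies *)

Section Nonvanishing.
Variable R : realType.

Lemma poly_nonroot (F : {poly R}) : F != 0 -> exists x, F.[x] != 0.
Proof.
move=> F0; apply: contrapT => H.
(* [size F] exceeds the degree by one, so these integers are too many to be roots. *)
have allr : all (root F) [seq i%:R | i <- iota 0 (size F)].
  by apply/allP => _ /mapP[i _ ->]; apply/negPn/negP => h; apply: H; exists i%:R.
have U : uniq [seq (i%:R : R) | i <- iota 0 (size F)].
  by rewrite map_inj_uniq ?iota_uniq// => i j /eqP; rewrite eqr_nat => /eqP.
by have := max_poly_roots F0 allr U; rewrite size_map size_iota ltnn.
Qed.

Lemma digits_inj n (B : nat) (a b : 'I_n -> nat) :
  (forall i, a i < B)%N -> (forall i, b i < B)%N ->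
  (\sum_(i < n) a i * B ^ i = \sum_(i < n) b i * B ^ i)%N -> a =1 b.
Proof.
elim: n a b => [|n IH] a b aB bB; first by move=> _ [].
rewrite !big_ord_recl /= !expn0 !muln1.
have S (u : 'I_n.+1 -> nat) : (\sum_(i < n) u (lift ord0 i) * B ^ bump 0 i =
    B * \sum_(i < n) u (lift ord0 i) * B ^ i)%N.
  by rewrite big_distrr; apply: eq_bigr => i _; rewrite /bump /= add1n expnS mulnCA.
rewrite !S => E.
have B0 : (0 < B)%N by exact: leq_ltn_trans (aB ord0).
have E0 : a ord0 = b ord0.
  by have := congr1 (modn^~ B) E; rewrite ![(_ + B * _)%N]addnC ![(B * _)%N]mulnC !modnMDl !modn_small.
move: E; rewrite E0 => /addnI /eqP; rewrite eqn_pmul2l// => /eqP /IH E1 i.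
by case: (unliftP ord0 i) => [j ->|->//]; rewrite E1.
Qed.

(* Kronecker substitution x_i := x ^ (B ^ i) separates the monomials. *)
Lemma mpoly_nonroot n (q : {mpoly R[n]}) : q <> 0 ->
  exists v : 'I_n -> R, mpoly.meval v q != 0.
Proof.
move=> /eqP q0; pose B := mpoly.mmeasure mpoly.mdeg q.
pose N (m : mpoly.multinom n) := (\sum_(i < n) m i * B ^ i)%N.
pose F : {poly R} := \sum_(m <- mpoly.msupp q) mpoly.mcoeff m q *: 'X^(N m).
have mB m : m \in mpoly.msupp q -> forall i, (m i < B)%N.
  move=> mq i; apply: leq_ltn_trans (mpoly.msize_mdeg_lt mq).
  by rewrite mpoly.mdegE (bigD1 i)//= leq_addr.
have F0 : F != 0.
  have m0 := mpoly.mlead_supp q0; set m := mpoly.mlead q in m0.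
  apply/eqP => /(congr1 (fun p : {poly R} => p`_(N m))).
  rewrite coef0 coef_sum (bigD1_seq m) ?mpoly.msupp_uniq//= coefZ coefXn eqxx mulr1.
  rewrite big1_seq ?addr0; first by move/eqP; rewrite -[_ == _]negbK -mpoly.mcoeff_msupp m0.
  move=> m' /andP[m'm m'q]; rewrite coefZ coefXn.
  case: eqP => [E|_]; last by rewrite mulr0.
  have := digits_inj (mB _ m0) (mB _ m'q) E => H.
  by move: m'm; rewrite (_ : m' = m) ?eqxx//; apply/mpoly.mnmP => i; rewrite H.
have [x Fx] := poly_nonroot F0.
exists (fun i => x ^+ (B ^ i)); rewrite mpoly.mevalE.
move: Fx; rewrite /F horner_sum; congr (_ != 0); apply: eq_bigr => m _.
rewrite hornerZ hornerXn; congr (_ * _).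
rewrite (big_morph _ (exprD x) (expr0 x)); apply: eq_bigr => i _.
by rewrite -exprM mulnC.
Qed.

End Nonvanishing.

(** * Orders of growth in L, up to polynomial factors in Y *)

Section Growth.
Variables (R : realType) (n : nat).
Local Notation Rn := 'rV[R]_n.
Implicit Types (F G A B : R -> Rn -> R) (L : R) (Y : Rn).

(* F(L, Y) = O(L^m) for L >= 1, up to a polynomial factor in Y. *)
Definition growth (m : nat) F := exists (C : R) (j : nat), 0 <= C /\
  forall L Y, 1 <= L -> `|F L Y| <= C * L ^+ m * (1 + sqnorm Y) ^+ j.

Let W1 Y : 1 <= 1 + sqnorm Y. Proof. by rewrite lerDl sqnorm_ge0. Qed.

Lemma growth_eq m F G : (forall L Y, F L Y = G L Y) -> growth m F -> growth m G.
Proof.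
move=> FG [C [j [C0 h]]]; exists C, j; split=> // L Y L1.
by rewrite -FG h.
Qed.

Lemma growthW m m' F : (m <= m')%N -> growth m F -> growth m' F.
Proof.
move=> mm' [C [j [C0 h]]]; exists C, j; split=> // L Y L1.
apply: le_trans (h L Y L1) _; rewrite ler_wpM2r ?exprn_ge0 ?(le_trans _ (W1 Y))//.
by rewrite ler_wpM2l// ler_weXn2l.
Qed.

Lemma growth_cst m (a : R) : growth m (fun _ _ => a).
Proof.
apply: (@growthW 0) => //; exists `|a|, 0%N; split=> // L Y _.
by rewrite !expr0 !mulr1.
Qed.

Lemma growth_exp m : growth m (fun L _ => L ^+ m).
Proof.
exists 1, 0%N; split=> // L Y L1.
by rewrite expr0 mulr1 mul1r ger0_norm// exprn_ge0// (le_trans _ L1).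
Qed.

Lemma growth_coord i : growth 0 (fun _ Y => Y 0 i).
Proof.
have [C [j [C0 h]]] := polyfun_bound (@Polyfun_coord R n i).
by exists C, j; split=> // L Y _; rewrite expr0 mulr1.
Qed.

Lemma growthD m F G : growth m F -> growth m G ->
  growth m (fun L Y => F L Y + G L Y).
Proof.
move=> [C [j [C0 h]]] [C' [j' [C0' h']]]; exists (C + C'), (j + j')%N.
split=> [|L Y L1]; first exact: addr_ge0.
have Lm : 0 <= L ^+ m by rewrite exprn_ge0// (le_trans _ L1).
apply: le_trans (ler_normD _ _) _; rewrite !mulrDl lerD//.
  apply: le_trans (h L Y L1) _; rewrite ler_wpM2l ?mulr_ge0//.
  by rewrite ler_weXn2l ?leq_addr.
apply: le_trans (h' L Y L1) _; rewrite ler_wpM2l ?mulr_ge0//.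
by rewrite ler_weXn2l ?leq_addl.
Qed.

Lemma growthM m m' F G : growth m F -> growth m' G ->
  growth (m + m') (fun L Y => F L Y * G L Y).
Proof.
move=> [C [j [C0 h]]] [C' [j' [C0' h']]]; exists (C * C'), (j + j')%N.
split=> [|L Y L1]; first exact: mulr_ge0.
rewrite normrM !exprD.
rewrite (_ : _ * _ * (_ * _) = (C * L ^+ m * (1 + sqnorm Y) ^+ j) *
  (C' * L ^+ m' * (1 + sqnorm Y) ^+ j')); last by ring.
by apply: ler_pM => //; [exact: h|exact: h'].
Qed.

Lemma growth_expM m m' F : growth m' F ->
  growth (m + m') (fun L Y => L ^+ m * F L Y).
Proof. exact: growthM (growth_exp m). Qed.

Lemma growth_expM0 m F : growth 0 F -> growth m (fun L Y => L ^+ m * F L Y).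
Proof. by move=> gF; have := growth_expM m gF; rewrite addn0. Qed.

Lemma growth_sum m (I : eqType) (r : seq I) (F : I -> R -> Rn -> R) :
  (forall i, i \in r -> growth m (F i)) ->
  growth m (fun L Y => \sum_(i <- r) F i L Y).
Proof.
elim: r => [|i r IH] h.
  by apply: growth_eq (growth_cst m 0) => L Y; rewrite big_nil.
apply: growth_eq (growthD (h i (mem_head _ _)) (IH _)) => [L Y|j jr].
  by rewrite big_cons.
by apply: h; rewrite in_cons jr orbT.
Qed.

Lemma growth_prod (I : Type) (r : seq I) (m : I -> nat) (F : I -> R -> Rn -> R) :
  (forall i, growth (m i) (F i)) ->
  growth (\sum_(i <- r) m i) (fun L Y => \prod_(i <- r) F i L Y).
Proof.
move=> h; elim: r => [|i r IH].
  by rewrite big_nil; apply: growth_eq (growth_cst 0 1) => L Y; rewrite big_nil.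
by rewrite big_cons; apply: growth_eq (growthM (h i) IH) => L Y; rewrite big_cons.
Qed.

Lemma growthX m k F : growth m F -> growth (k * m) (fun L Y => F L Y ^+ k).
Proof.
move=> h; elim: k => [|k IH].
  by apply: growth_eq (growth_cst _ 1) => L Y; rewrite expr0.
by rewrite mulSn; apply: growth_eq (growthM h IH) => L Y; rewrite exprS.
Qed.

Lemma growth_meval (D K l : nat) (q : {mpoly R[l]}) (X : 'I_l -> R -> Rn -> R) :
  is_form K q -> (forall i, growth D (X i)) ->
  growth (D * K) (fun L Y => mpoly.meval (fun i => X i L Y) q).
Proof.
move=> /mpoly.dhomogP hq hX.
apply: (@growth_eq _ (fun L Y => \sum_(m <- mpoly.msupp q)
   mpoly.mcoeff m q * \prod_i X i L Y ^+ m i)).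
  by move=> L Y; rewrite mpoly.mevalE.
apply: growth_sum => m mq; rewrite -[(D * K)%N]add0n; apply: growthM.
  exact: growth_cst.
have -> : K = mpoly.mdeg m by rewrite -(hq _ mq).
rewrite mpoly.mdegE big_distrr /=.
apply: (growth_prod _ (m := fun i => (D * m i)%N)) => i.
by rewrite mulnC; exact: growthX.
Qed.

(* The last condition says that A - B = O(L^(D (K - 1))); this form of it also
   covers K = 0. *)
Definition lead_close (D K : nat) A B := [/\ growth (D * K) A, growth (D * K) B &
  growth (D * K) (fun L Y => L ^+ D * (A L Y - B L Y))].

Lemma close_cst D (a : R) : lead_close D 0 (fun _ _ => a) (fun _ _ => a).
Proof.
split; [exact: growth_cst|exact: growth_cst|].
by apply: growth_eq (growth_cst _ 0) => L Y; rewrite subrr mulr0.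
Qed.

(** A A' - B B' = A (A' - B') + B' (A - B), so that one factor is replaced at a time. *)
Lemma closeM D K K' A B A' B' : lead_close D K A B -> lead_close D K' A' B' ->
  lead_close D (K + K') (fun L Y => A L Y * A' L Y) (fun L Y => B L Y * B' L Y).
Proof.
move=> [hA hB hAB] [hA' hB' hAB'].
rewrite /lead_close mulnDr; split; [exact: growthM|exact: growthM|].
apply: growth_eq (growthD (growthM hA hAB') (growthM hAB hB')) => L Y; ring.
Qed.

Lemma close_prod D (I : Type) (r : seq I) (m : I -> nat) (A B : I -> R -> Rn -> R) :
  (forall i, lead_close D (m i) (A i) (B i)) ->
  lead_close D (\sum_(i <- r) m i) (fun L Y => \prod_(i <- r) A i L Y)
    (fun L Y => \prod_(i <- r) B i L Y).
Proof.
move=> h; elim: r => [|i r IH].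
  rewrite big_nil; have [h1 h2 h3] := close_cst D 1.
  split; [apply: growth_eq h1|apply: growth_eq h2|apply: growth_eq h3] => L Y;
    by rewrite !big_nil.
rewrite big_cons; have [h1 h2 h3] := closeM (h i) IH.
by split; [apply: growth_eq h1|apply: growth_eq h2|apply: growth_eq h3] => L Y;
  rewrite !big_cons.
Qed.

Lemma closeX D K k A B : lead_close D K A B ->
  lead_close D (k * K) (fun L Y => A L Y ^+ k) (fun L Y => B L Y ^+ k).
Proof.
move=> h; elim: k => [|k IH].
  have [h1 h2 h3] := close_cst D 1.
  by split; [apply: growth_eq h1|apply: growth_eq h2|apply: growth_eq h3] => L Y;
    rewrite !expr0.
rewrite mulSn; have [h1 h2 h3] := closeM h IH.
by split; [apply: growth_eq h1|apply: growth_eq h2|apply: growth_eq h3] => L Y;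
  rewrite !exprS.
Qed.

(** Moving the arguments of a form by O(1) changes its value by one factor L^D less than its size.
    This allows [Q k] and [Q (k - 1)] to be frozen at L^D v. *)
Lemma close_meval (D K l : nat) (q : {mpoly R[l]}) (A B : 'I_l -> R -> Rn -> R) :
  is_form K q -> (forall i, lead_close D 1 (A i) (B i)) ->
  growth (D * K) (fun L Y => L ^+ D * (mpoly.meval (fun i => A i L Y) q -
    mpoly.meval (fun i => B i L Y) q)).
Proof.
move=> /mpoly.dhomogP hq hX.
apply: (@growth_eq _ (fun L Y => \sum_(m <- mpoly.msupp q) mpoly.mcoeff m q *
   (L ^+ D * (\prod_i A i L Y ^+ m i - \prod_i B i L Y ^+ m i)))).
  move=> L Y; rewrite !mpoly.mevalE -sumrB big_distrr /=.
  by apply: eq_bigr => m _; ring.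
apply: growth_sum => m mq; rewrite -[(D * K)%N]add0n; apply: growthM.
  exact: growth_cst.
have -> : K = mpoly.mdeg m by rewrite -(hq _ mq).
rewrite mpoly.mdegE.
have [] // := @close_prod D _ (index_enum 'I_l) (fun i => m i)
  (fun i L Y => A i L Y ^+ m i) (fun i L Y => B i L Y ^+ m i).
by move=> i; rewrite -[X in lead_close _ X](muln1 (m i)); exact: closeX.
Qed.

Lemma form_scale (K l : nat) (q : {mpoly R[l]}) (r : R) (v : 'I_l -> R) :
  is_form K q ->
  mpoly.meval (fun i => r * v i) q = r ^+ K * mpoly.meval v q.
Proof.
move=> /mpoly.dhomogP hq; rewrite !mpoly.mevalE big_distrr /=.
rewrite big_seq [RHS]big_seq; apply: eq_bigr => m mq.
have -> : K = mpoly.mdeg m by rewrite -(hq _ mq).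
rewrite mpoly.mdegE mulrCA; congr (_ * _).
rewrite (big_morph _ (exprD r) (expr0 r)) -big_split /=.
by apply: eq_bigr => i _; rewrite exprMn.
Qed.

End Growth.

(** * The phase near the centre of the packet *)

Section Phase.
Variables (R : realType) (n k d : nat).
Hypotheses (hn : (2 <= n)%N) (hk : (2 <= k)%N).
Variables (P : {mpoly R[n]}) (Q : nat -> {mpoly R[n.-1]}).
Hypothesis hP : total_degree P k.
Hypothesis hQ : forall i : nat, (i <= 1)%N \/ (d <= i <= k)%N ->
  is_form (k - i) (Q (k - i)%N).
Hypothesis hlead : homog_part k P = leading_form hn k d Q.

Local Notation i0 := (first_index hn).
Local Notation ev p x := (mpoly.meval x p).

Lemma meval_leading_form (x : 'I_n -> R) :
  ev (leading_form hn k d Q) x =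
  ev (Q k) (fun j => x (lift i0 j)) + x i0 * ev (Q (k - 1)%N) (fun j => x (lift i0 j)) +
  \sum_(d <= i < k.+1) x i0 ^+ i * ev (Q (k - i)%N) (fun j => x (lift i0 j)).
Proof.
have E q : ev (embed hn q) x = ev q (fun j => x (lift i0 j)).
  rewrite /embed mpoly.comp_mpoly_meval; apply: mpoly.meval_eq => j.
  by rewrite tnth_mktuple mpoly.mevalXU.
rewrite /leading_form !mpoly.mevalD mpoly.mevalM !E mpoly.mevalXU; congr (_ + _).
rewrite raddf_sum /=; apply: eq_bigr => i _.
by rewrite mpoly.mevalM rmorphXn /= mpoly.mevalXU E.
Qed.

Variables (D e : nat) (v : 'I_n.-1 -> R).
Hypothesis eD : (e <= D)%N.
(** Written without subtraction, the inequality says that t xi_1^i Q_{k-i} stays bounded for t of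
    order L^(-D(k-1)). *)
Hypothesis hcond : forall i, (d <= i <= k)%N ->
  Q (k - i)%N = 0 \/ (e * i + D * (k - i) + D <= D * k)%N.

(** The frequency as an affine function of the standardised variable Y, that is, the inverse of
    [normalized] for the widths and the centre of the packet. *)
Definition freq (i : 'I_n) (L : R) (Y : 'rV[R]_n) : R :=
  if unlift i0 i is Some j then L ^+ D * v j + Y 0 i else L ^+ e * Y 0 i.

Lemma freq_first L Y : freq i0 L Y = L ^+ e * Y 0 i0.
Proof. by rewrite /freq unlift_none. Qed.

Lemma freq_lift j L Y : freq (lift i0 j) L Y = L ^+ D * v j + Y 0 (lift i0 j).
Proof. by rewrite /freq liftK. Qed.

Lemma growth_freq i : growth D (freq i).
Proof.
rewrite /freq; case: unliftP => [j _|_].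
  exact: (growthD (growth_expM0 D (@growth_cst R n 0 (v j)))
    (growthW (leq0n D) (@growth_coord R n i))).
exact: (growthW eD (growth_expM0 e (@growth_coord R n i))).
Qed.

(** What is subtracted from P is a constant and the term linear in xi_1, which the choice of t will
    cancel against x_1 xi_1. The rest is O(L^(D(k-1))), hence bounded after multiplication by t; the
    extra factor L^D avoids a subtraction in the exponent. *)
Lemma phase_growth : growth (D * k) (fun L Y => L ^+ D *
  (ev P (fun i => freq i L Y) - L ^+ (D * k) * ev (Q k) v -
   L ^+ e * Y 0 i0 * (L ^+ (D * (k - 1)) * ev (Q (k - 1)%N) v))).
Proof.
have k1 : (D + D * k.-1 = D * k)%N by case: (k) hk => // k' _; rewrite mulnS.
have hQk : is_form k (Q k) by have := hQ (or_introl (leq0n 1)); rewrite subn0.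
have hQk1 : is_form (k - 1) (Q (k - 1)%N) := hQ (or_introl (leqnn 1)).
have cl j : lead_close D 1 (fun L Y => freq (lift i0 j) L Y) (fun L (_ : 'rV[R]_n) => L ^+ D * v j).
  rewrite /lead_close muln1; split; first exact: growth_freq.
    exact: (growth_expM0 D (@growth_cst R n 0 (v j))).
  apply: (@growth_eq _ _ _ (fun L Y => L ^+ D * Y 0 (lift i0 j))).
    by move=> L Y; rewrite freq_lift; congr (_ * _); ring.
  exact: (growth_expM0 D (@growth_coord R n (lift i0 j))).
have fs := fun (q : {mpoly R[n.-1]}) K (h : is_form K q) (L : R) => form_scale (L ^+ D) v h.
(* The parts of P of degree j < k have order D j <= D (k - 1). *)
have g1 : growth (D * k) (fun L Y => L ^+ D * \sum_(j < k) ev (mpoly.pihomog mpoly.mdeg j P) (fun i => freq i L Y)).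
  rewrite -k1; apply: growth_expM.
  apply: growth_sum => j _; apply: (@growthW _ _ (D * j)).
    by rewrite leq_mul2l -ltnS prednK ?ltn_ord ?orbT// (leq_trans _ hk).
  by apply: growth_meval; [exact: mpoly.pihomogP|exact: growth_freq].
have g2 := close_meval hQk cl.
(* The factor xi_1 costs L^e, which the gain L^D from freezing [Q (k - 1)] pays for because e <=
   D. *)
have g3 : growth (D * k) (fun L Y => L ^+ e * Y 0 i0 *
   (L ^+ D * (ev (Q (k - 1)%N) (fun j => freq (lift i0 j) L Y) -
     ev (Q (k - 1)%N) (fun j => L ^+ D * v j)))).
  apply: (@growthW _ _ (e + D * (k - 1))); first by rewrite -k1 -subn1 leq_add2r.
  exact: (growthM (growth_expM0 e (@growth_coord R n i0)) (close_meval hQk1 cl)).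
(* These terms are not approximated: [hcond] bounds each of them outright. *)
have g4 : growth (D * k) (fun L Y => \sum_(i <- index_iota d k.+1)
   L ^+ D * (freq i0 L Y ^+ i * ev (Q (k - i)%N) (fun j => freq (lift i0 j) L Y))).
  apply: growth_sum => i; rewrite mem_index_iota ltnS => /[dup] dik /hcond[->|le].
    by apply: growth_eq (@growth_cst R n _ 0) => L Y; rewrite mpoly.meval0 !mulr0.
  apply: (growthW le); rewrite addnC mulnC; apply: growth_expM.
  have gf : growth e (freq i0).
    apply: growth_eq (growth_expM0 e (@growth_coord R n i0)) => L Y.
    by rewrite freq_first.
  apply: (growthM (growthX i gf)); apply: growth_meval => [|j]; last exact: growth_freq.
  by apply: hQ; right.
apply: growth_eq (growthD (growthD g1 g2) (growthD g3 g4)) => L Y.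
have -> : ev P (fun i => freq i L Y) =
    \sum_(j < k) ev (mpoly.pihomog mpoly.mdeg j P) (fun i => freq i L Y) +
    ev (leading_form hn k d Q) (fun i => freq i L Y).
  rewrite {1}(@mpoly.pihomog_partitionE _ _ mpoly.mdeg k.+1 P); last by rewrite hP.
  by rewrite big_ord_recr /= mpoly.mevalD raddf_sum -hlead.
rewrite meval_leading_form (fs _ _ hQk) (fs _ _ hQk1) -!exprM freq_first -big_distrr /=.
ring.
Qed.

End Phase.

(** * Widths and centre of the packet as functions of L *)

Section Scaling.
Variables (R : realType) (n : nat) (hn : (2 <= n)%N).
Variables (D e : nat) (eD : (e <= D)%N) (v : 'I_n.-1 -> R).

Local Notation i0 := (first_index hn).
Local Notation freq := (freq hn D e v).

Definition bandwidth (L : R) (i : 'I_n) : R := if i == i0 then L ^+ e else 1.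

Definition carrier (L : R) : 'rV[R]_n :=
  \row_i (if unlift i0 i is Some j then L ^+ D * v j else 0).

Lemma bandwidth_gt0 L : 0 < L -> forall i, 0 < bandwidth L i.
Proof. by move=> L0 i; rewrite /bandwidth; case: ifP => // _; rewrite exprn_gt0. Qed.

Lemma freq_normalized L (xi : 'rV[R]_n) i : 0 < L ->
  freq i L (normalized (bandwidth L) (carrier L) xi) = xi 0 i.
Proof.
move=> L0; rewrite /freq /bandwidth !mxE.
case: unliftP => [j ->|->].
  by rewrite eq_sym (negbTE (neq_lift _ _)) divr1; ring.
by rewrite eqxx subr0 mulrCA mulfV ?mulr1// expf_neq0// gt_eqF.
Qed.

(** Frequencies are O(L^D) up to the standardised variable, so for s >= 0 the Sobolev weight costs
    at most a multiple of L^(2 D s). *)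
Lemma sqnorm_le_scaled : exists2 B : R, 0 < B & forall L (xi : 'rV[R]_n), 1 <= L ->
  1 + sqnorm xi <= B * L ^+ (2 * D) * (1 + sqnorm (normalized (bandwidth L) (carrier L) xi)).
Proof.
pose w i := if unlift i0 i is Some j then v j else 0.
pose V := \sum_i w i ^+ 2.
have V0 : 0 <= V by rewrite sumr_ge0// => i _; exact: sqr_ge0.
(* From (a + b)^2 <= 2 a^2 + 2 b^2, with V = |v|^2. *)
exists (3 + 2 * V); first by lra.
move=> L xi L1; have L0 : 0 < L by apply: lt_le_trans L1.
set Y := normalized _ _ _; set T := L ^+ (2 * D).
have T1 : 1 <= T by rewrite exprn_ege1.
have h i : xi 0 i * xi 0 i <= T * (2 * w i ^+ 2 + 2 * (Y 0 i * Y 0 i)).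
  rewrite -(freq_normalized xi i L0) -/Y /freq /w /T mulnC exprM -expr2.
  set l := L ^+ D; have l1 : 1 <= l by rewrite exprn_ege1.
  case: (unlift i0 i) => [j|].
    have := sqr_ge0 (l * v j - Y 0 i).
    have : Y 0 i ^+ 2 <= l ^+ 2 * Y 0 i ^+ 2 by rewrite ler_peMl ?sqr_ge0// exprn_ege1.
    by nra.
  have : (L ^+ e * Y 0 i) ^+ 2 <= l ^+ 2 * Y 0 i ^+ 2.
    rewrite exprMn ler_wpM2r ?sqr_ge0// lerXn2r ?nnegrE ?exprn_ge0 ?(ltW L0)//.
    by rewrite ler_weXn2l.
  have : 0 <= l ^+ 2 * Y 0 i ^+ 2 by rewrite mulr_ge0 ?sqr_ge0.
  by rewrite -expr2; nra.
have : sqnorm xi <= T * (2 * V + 2 * sqnorm Y).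
  rewrite /sqnorm /dot /V !mulr_sumr -big_split /= mulr_sumr.
  by apply: ler_sum => i _; exact: h.
have := sqnorm_ge0 Y; set S := sqnorm Y => S0 hS.
have : 0 <= T * (V * S) by rewrite !mulr_ge0// (le_trans _ T1).
have : 0 <= T * S by rewrite mulr_ge0// (le_trans _ T1).
by nra.
Qed.

(** The inverse of [L ^+ e] is the gain in the squared Sobolev norm; it comes from the first
    direction alone. *)
Lemma prod_normal_peak L : 0 < L ->
  \prod_i normal_peak (bandwidth L i) = (L ^+ e)^-1 * (Num.sqrt (pi *+ 2))^-1 ^+ n.
Proof.
move=> L0; under eq_bigr => i _ do rewrite (normal_peakE (bandwidth_gt0 L0 i)) invfM.
rewrite big_split /= prodr_const card_ord; congr (_ * _).
rewrite (bigD1 i0)//= /bandwidth eqxx big1 ?mulr1// => i /negbTE ->.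
by rewrite invr1.
Qed.

End Scaling.

(** * The counterexample *)

Section Counterexample.
Variables (R : realType) (n k d : nat).
Hypotheses (hn : (2 <= n)%N) (hk : (2 <= k)%N).
Variables (P : {mpoly R[n]}) (Q : nat -> {mpoly R[n.-1]}).
Hypothesis hP : total_degree P k.
Hypothesis hQ : forall i : nat, (i <= 1)%N \/ (d <= i <= k)%N ->
  is_form (k - i) (Q (k - i)%N).
Hypothesis hlead : homog_part k P = leading_form hn k d Q.
Variables (D e : nat) (v : 'I_n.-1 -> R).
Hypothesis eD : (e <= D)%N.
Hypothesis hcond : forall i, (d <= i <= k)%N ->
  Q (k - i)%N = 0 \/ (e * i + D * (k - i) + D <= D * k)%N.
Hypothesis qv : mpoly.meval v (Q (k - 1)%N) != 0.

Local Notation i0 := (first_index hn).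
Local Notation mu := (lebesgue_rV R n).
Local Notation bw L := (bandwidth hn e L).
Local Notation cr L := (carrier hn D v L).
Local Notation wp L := (packet (bw L) (cr L)).

Lemma sqnorm_coord_norm_le (Y : 'rV[R]_n) i : `|Y 0 i| <= 1 + sqnorm Y.
Proof.
have := sqr_coord_le Y i; rewrite -real_normK ?num_real//.
by have := normr_ge0 (Y 0 i); nra.
Qed.

(* At the time t with t q L^(D (k - 1)) = - x_1, the linear part in xi_1 of the
   phase cancels. *)
Lemma T_packet_ge_half : exists delta, [/\ 0 < delta, 4 * delta * n%:R <= 1 &
  forall (L : R) (x : 'rV[R]_n), 1 <= L -> (forall i, `|x 0 i| <= 2 * delta) ->
  0 < - (x 0 i0 / mpoly.meval v (Q (k - 1)%N)) ->
  exists2 t, 0 < t < 1 & 2^-1 <= cabs (T_schwartz P t (wp L) x)].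
Proof.
have := qv; set q := mpoly.meval v _ => q_neq0.
have [C [j [C0 hC]]] := phase_growth hk hP hQ hlead v eD hcond.
(* One power more than [j], since the linear terms x_i Y_i must also be absorbed, even when j =
   0. *)
have [M M0 hM] := density_moment R n j.+1.
have q0 : 0 < `|q| by rewrite normr_gt0.
pose a := n%:R + C / `|q|.
have a0 : 0 <= a by rewrite addr_ge0// divr_ge0.
have aM0 : 0 <= a * M by rewrite mulr_ge0.
have iq0 : 0 < `|q|^-1 by rewrite invr_gt0.
(* With delta = 1 / Z, the summands of Z give in turn room for the box inside the unit ball, t < 1,
   and a mean phase error 2 delta a M of at most 1/2. *)
pose Z := 1 + 4 * n%:R + 4 / `|q| + 4 * (a * M).
have n0 : 0 <= n%:R :> R by [].
have Z0 : 0 < Z by rewrite /Z; lra.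
have [delta [d0 dZ]] : exists delta, 0 < delta /\ delta * Z = 1.
  by exists Z^-1; rewrite invr_gt0 mulVf ?gt_eqF.
have p1 : 0 <= delta * n%:R by rewrite mulr_ge0// ltW.
have p2 : 0 <= delta / `|q| by rewrite mulr_ge0// ltW.
have p3 : 0 <= delta * (a * M) by rewrite mulr_ge0// ltW.
have dZ' : delta + 4 * (delta * n%:R) + 4 * (delta / `|q|) + 4 * (delta * (a * M)) = 1.
  by rewrite -[RHS]dZ /Z; ring.
exists delta; split=> [//||L x L1 hx x0]; first by lra.
have L0 : 0 < L by apply: lt_le_trans L1.
pose T := L ^+ (D * (k - 1)); have T1 : 1 <= T by rewrite exprn_ege1.
have T0 : 0 < T by apply: lt_le_trans T1.
pose t := - (x 0 i0 / q) / T.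
have tT : `|t| * T <= 2 * (delta / `|q|).
  rewrite /t normrM normfV (gtr0_norm T0) divfK ?gt_eqF// normrN normrM normfV mulrA.
  by rewrite ler_pM2r.
have t0 : 0 < t by rewrite divr_gt0.
have t1 : t < 1.
  by have := gtr0_norm t0; have : `|t| <= `|t| * T by [rewrite ler_peMr]; lra.
exists t; first by rewrite t0 t1.
(* The part of the phase that does not depend on Y. *)
pose th := \sum_(i | i != i0) x 0 i * cr L 0 i + t * (L ^+ (D * k) * mpoly.meval v (Q k)).
apply: (@T_packet_lower R n P t th (2 * delta * a) M j.+1).
- exact: bandwidth_gt0.
- by rewrite !mulr_ge0// ltW.
- by lra.
- by apply: hM; exact: bandwidth_gt0.
move=> xi; set Y := normalized _ _ _.
pose Ph := peval P xi - L ^+ (D * k) * mpoly.meval v (Q k) - L ^+ e * Y 0 i0 * (T * q).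
have W1 : 1 <= 1 + sqnorm Y by rewrite lerDl sqnorm_ge0.
have hPh : `|Ph| <= C * T * (1 + sqnorm Y) ^+ j.
  have := hC L Y L1.
  have -> : mpoly.meval (fun i => freq hn D e v i L Y) P = peval P xi.
    by apply: mpoly.meval_eq => i; exact: freq_normalized.
  rewrite -/q -/T -/Ph normrM gtr0_norm ?exprn_gt0//.
  have -> : L ^+ (D * k) = L ^+ D * T.
    by rewrite /T -exprD -mulnS subn1 prednK// (leq_trans _ hk).
  rewrite (_ : C * _ * _ = L ^+ D * (C * T * (1 + sqnorm Y) ^+ j)); last by ring.
  by rewrite ler_pM2l// exprn_gt0.
have xiE i : i != i0 -> xi 0 i = cr L 0 i + Y 0 i.
  move=> ii0; rewrite /Y [normalized _ _ _ 0 i]mxE /bandwidth (negbTE ii0) divr1; ring.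
have xi0E : xi 0 i0 = L ^+ e * Y 0 i0.
  by rewrite -(freq_normalized hn D e v xi i0 L0) freq_first.
have -> : dot x xi + peval P xi * t - th = \sum_(i | i != i0) x 0 i * Y 0 i + t * Ph.
  rewrite /dot (bigD1 i0)//= xi0E.
  have -> : \sum_(i | i != i0) x 0 i * xi 0 i =
     \sum_(i | i != i0) x 0 i * cr L 0 i + \sum_(i | i != i0) x 0 i * Y 0 i.
    by rewrite -big_split /=; apply: eq_bigr => i ii0; rewrite (xiE _ ii0) mulrDr.
  have tq : t * (T * q) = - x 0 i0 by rewrite /t; field; rewrite q_neq0 gt_eqF.
  rewrite /Ph /th !mulrBr (mulrCA t (L ^+ e * _)) tq.
  ring.
apply: le_trans (ler_normD _ _) _.
rewrite (_ : 2 * delta * a * _ = 2 * delta * n%:R * (1 + sqnorm Y) ^+ j.+1 +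
  2 * delta * (C / `|q|) * (1 + sqnorm Y) ^+ j.+1); last by rewrite /a; ring.
apply: lerD.
  apply: le_trans (_ : \sum_(i < n) 2 * delta * (1 + sqnorm Y) <= _).
    apply: le_trans (ler_norm_sum _ _ _) _.
    rewrite [leRHS](bigID (fun i => i == i0))/= ler_wpDl//.
      by rewrite sumr_ge0// => i _; rewrite !mulr_ge0 ?(ltW d0)// (le_trans _ W1).
    apply: ler_sum => i _; rewrite normrM; apply: ler_pM => //.
    exact: sqnorm_coord_norm_le.
  have -> : \sum_(i < n) 2 * delta * (1 + sqnorm Y) = 2 * delta * n%:R * (1 + sqnorm Y).
    by rewrite sumr_const card_ord -[LHS]mulr_natr mulrAC.
  apply: ler_wpM2l; first by rewrite -mulrA mulr_ge0.
  by rewrite exprS ler_peMr ?exprn_ege1// (le_trans _ W1).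
rewrite normrM; apply: le_trans (_ : `|t| * (C * T * (1 + sqnorm Y) ^+ j) <= _).
  by rewrite ler_wpM2l.
apply: le_trans (_ : 2 * (delta / `|q|) * (C * (1 + sqnorm Y) ^+ j) <= _).
  rewrite (_ : `|t| * _ = `|t| * T * (C * (1 + sqnorm Y) ^+ j)); last by ring.
  by rewrite ler_wpM2r// mulr_ge0// exprn_ge0// (le_trans _ W1).
rewrite (_ : 2 * delta * (C / `|q|) * _ = 2 * (delta / `|q|) * (C * (1 + sqnorm Y) ^+ j.+1)); last by ring.
apply: ler_wpM2l; first by rewrite mulr_ge0.
by rewrite ler_wpM2l// ler_weXn2l.
Qed.

(** The good positions fill a cube of side delta, whose volume is independent of L; only the time at
    which a position is good depends on L. *)
Lemma maximal_lower : exists2 c, 0 < c & forall (L : R) (u : R -> 'rV[R]_n -> R[i]),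
  1 <= L -> (forall t, 0 < t < 1 -> u t = T_schwartz P t (wp L)) ->
  measurable_fun (@unit_ball R n) (maximal u) ->
  (c%:E <= \int[mu]_(x in @unit_ball R n) maximal u x)%E.
Proof.
have [delta [d0 dn hT]] := T_packet_ge_half.
set q := mpoly.meval v _ in hT.
have q0 : q != 0 by exact: qv.
(* The first coordinate has the sign opposite to that of q, so that t > 0, and it stays away from
   0. *)
pose lo : R := if q < 0 then delta else - (2 * delta).
pose A (i : 'I_n) : set (measurableTypeR R) :=
  if i == i0 then `[lo, lo + delta]%classic else `[0, delta]%classic.
have mA i : measurable (A i) by rewrite /A; case: ifP => _; exact: measurable_itv.
have leb a : lebesgue_measure (`[a, a + delta]%classic : set (measurableTypeR R)) = delta%:E.
  by rewrite lebesgue_measure_itv /= lte_fin ltrDl d0 -EFinB addrAC subrr add0r.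
pose box := [set x : 'rV[R]_n | forall i, A i (x 0 i)].
have mubox : mu box = (delta ^+ n)%:E.
  rewrite lebesgue_rV_box// (eq_bigr (fun=> delta%:E)); last first.
    by move=> i _; rewrite /A; case: ifP => _; [exact: leb|rewrite -(leb 0) add0r].
  by rewrite prodEFin prodr_const card_ord.
have mbox : measurable box.
  rewrite (_ : box = \bigcap_(i in [set: 'I_n]) ((fun x => x 0 i) @^-1` A i)).
    apply: fin_bigcap_measurable; first exact: finite_finset.
    move=> i _; rewrite -[X in measurable X]setTI; exact: measurable_coord.
  by apply/seteqP; split=> x /= Bx i => [_|]; exact: Bx.
have hbox x : box x -> (forall i, `|x 0 i| <= 2 * delta) /\ 0 < - (x 0 i0 / q).
  move=> Bx; split=> [i|].
    have := Bx i; rewrite /A /lo; case: ifP => _.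
      by rewrite /= in_itv /=; case: ifP => _ h; rewrite ler_norml; lra.
    by rewrite /= in_itv /= => h; rewrite ler_norml; lra.
  have := Bx i0; rewrite /A eqxx /lo /= in_itv /=; case: ltP => qs h.
    by rewrite -mulrN -invrN mulr_gt0// ?invr_gt0; lra.
  by rewrite -mulNr mulr_gt0// ?invr_gt0 ?lt_def ?q0//; lra.
have boxball : box `<=` @unit_ball R n.
  move=> x /hbox[hx _]; rewrite /unit_ball /= /sqnorm /dot.
  apply: le_lt_trans (_ : \sum_(i < n) 4 * delta * delta < 1).
    apply: ler_sum => i _; have := hx i; rewrite -expr2 -real_normK ?num_real//.
    by have := normr_ge0 (x 0 i); nra.
  rewrite sumr_const card_ord -[ltLHS]mulr_natr.
  have n1 : 2 <= n%:R :> R by rewrite ler_nat.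
  by nra.
exists (2^-1 * delta ^+ n); first by rewrite mulr_gt0 ?exprn_gt0.
move=> L u L1 hu mu_u.
have mball : measurable (@unit_ball R n).
  have msq : measurable_fun setT (@sqnorm R n).
    by apply: measurable_sum => i; apply: measurable_funM; exact: measurable_coord.
  have := msq measurableT `]-oo, 1[%classic (measurable_itv _); rewrite setTI.
  by rewrite (_ : _ @^-1` _ = @unit_ball R n).
have max_ge x t : 0 < t < 1 -> ((cabs (T_schwartz P t (wp L) x))%:E <= maximal u x)%E.
  by move=> t01; apply: ereal_sup_ubound; exists t => //; rewrite (hu _ t01).
apply: le_trans (_ : (\int[mu]_(x in box) maximal u x <= _)%E); last first.
  (* A supremum in the extended reals is nonnegative only once some member is known to be; the time
     1/2 supplies one. *)
  apply: ge0_subset_integral => // x _.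
  apply: le_trans (max_ge x 2^-1 _); first by rewrite lee_fin cabs_ge0.
  by rewrite invr_gt0 ltr0n/= invf_lt1 ?ltr1n.
apply: le_trans (_ : (\int[mu]_(x in box) (2^-1)%:E <= _)%E).
  rewrite integral_cst// EFinM le_eqVlt; apply/orP; left; apply/eqP.
  exact: (congr1 (fun z => ((2^-1)%:E * z)%E) (esym mubox)).
apply: ge0_le_integral => //.
- exact: (measurable_funS mball boxball mu_u).
- move=> x /hbox[hx x0]; have [t t01 ht] := hT L x L1 hx x0.
  by apply: le_trans (max_ge x t t01); rewrite lee_fin.
Qed.

(** The bounds on s' serve separately: s' >= 0 makes the weight monotone in its base, and s' <= 1
    lets the first moment control the power s' of 1 + |Y|^2. *)
Lemma packet_norm_upper (s' : R) : 0 <= s' <= 1 ->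
  exists2 C, 0 <= C & forall L s, 1 <= L -> s <= s' ->
  (sobolev_sqnorm s (fourier (wp L)) <= (C * ((L ^+ (2 * D)) `^ s' / L ^+ e))%:E)%E.
Proof.
move=> /andP[s0 s1].
have [M M0 hM] := density_moment R n 1.
have [B B0 hB] := sqnorm_le_scaled hn eD v.
pose p := (Num.sqrt (pi *+ 2) : R)^-1 ^+ n.
have p0 : 0 <= p by rewrite exprn_ge0// invr_ge0 sqrtr_ge0.
exists ((2 * pi) ^+ n * p * B `^ s' * M).
  by rewrite !mulr_ge0 ?powR_ge0// exprn_ge0// mulr_ge0// pi_ge0.
move=> L s L1 ss'; have L0 : 0 < L by apply: lt_le_trans L1.
have LD : 0 <= L ^+ (2 * D) by rewrite exprn_ge0// ltW.
have := @sobolev_packet_le R n s (B `^ s' * (L ^+ (2 * D)) `^ s') M 1 (bw L) (cr L)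
  (bandwidth_gt0 _ _ L0) (hM _ _ (bandwidth_gt0 _ _ L0)).
rewrite prod_normal_peak// => h; apply: le_trans (h _ _) _.
- by rewrite mulr_ge0 ?powR_ge0.
- move=> xi; set Y := normalized _ _ _.
  have X1 : 1 <= 1 + sqnorm xi by rewrite lerDl sqnorm_ge0.
  have W1 : 1 <= 1 + sqnorm Y by rewrite lerDl sqnorm_ge0.
  apply: le_trans (ler_powR X1 ss') _.
  have W0 : 0 <= 1 + sqnorm Y by apply: le_trans W1.
  apply: le_trans (_ : (B * L ^+ (2 * D) * (1 + sqnorm Y)) `^ s' <= _).
    apply: ge0_ler_powR => //; rewrite ?nnegrE; last exact: hB.
      by apply: le_trans X1.
    by rewrite !mulr_ge0// ltW.
  rewrite !powRM ?mulr_ge0 ?(ltW B0)// expr1 ler_wpM2l ?mulr_ge0 ?powR_ge0//.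
  exact: ler1_powR.
- rewrite lee_fin le_eqVlt; apply/orP; left; apply/eqP; rewrite -/p; ring.
Qed.

Lemma sobolev_exponent_ge (s K : R) : (0 < e)%N ->
  maximal_estimate P s K -> e%:R / (2 * D%:R) <= s.
Proof.
move=> e0 hK; rewrite leNgt; apply/negP => sl.
have D0 : (0 < D)%N by apply: leq_trans eD.
have eR : 0 < e%:R :> R by rewrite ltr0n.
have DR : 0 < D%:R :> R by rewrite ltr0n.
have eDR : e%:R <= D%:R :> R by rewrite ler_nat.
(* For s < 0 the weight decreases with frequency. It is bounded by the weight of exponent max(s, 0),
   which is still below the positive threshold. *)
pose s' := Num.max s 0.
have s'0 : 0 <= s' by rewrite le_max lexx orbT.
have ss' : s <= s' by rewrite le_max lexx.
have sl' : s' < e%:R / (2 * D%:R) by rewrite gt_max sl divr_gt0// mulr_gt0.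
have s'1 : s' <= 1.
  by apply: le_trans (ltW sl') _; rewrite ler_pdivrMr ?mulr_gt0//; lra.
pose g := e%:R - 2 * D%:R * s'.
have g0 : 0 < g by move: sl'; rewrite ltr_pdivlMr ?mulr_gt0// /g; lra.
have [c c0 hc] := maximal_lower.
have s'01 : 0 <= s' <= 1 by rewrite s'0.
have [C C0 hC] := packet_norm_upper s'01.
have key (r : R) : 0 <= r -> c ^+ 2 <= K ^+ 2 * (C * expR (- (g * r))).
  move=> r0; set L := expR r; have L1 : 1 <= L by rewrite -expR0 ler_expR.
  have L0 : 0 < L by exact: expR_gt0.
  have sphi : schwartz (wp L).
    by apply: schwartz_packet => i; rewrite gt_eqF// bandwidth_gt0.
  have mF : cmeasurable (fourier (wp L)).
    rewrite (_ : fourier _ = fun xi => (((2 * pi) ^+ n * density (bw L) (cr L) xi)%:C)%C).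
      by split => //=; apply: measurable_funM => //; exact: measurable_density.
    by apply/funext => xi; rewrite fourier_packet//; exact: bandwidth_gt0.
  have up := hC L s L1 ss'.
  have ins : in_sobolev s (dist (wp L)) (fourier (wp L)).
    split; [exact: tempered_dist|exact: is_function_dfourier|].
    exact: le_lt_trans up (ltry _).
  have [u [uT mu_u hu]] := hK _ _ ins.
  have uE t : 0 < t < 1 -> u t = T_schwartz P t (wp L).
    by move=> t01; have [_ hT] := uT t t01; apply: hT => //; exact: is_function_dist.
  have := le_trans (hc L u L1 uE mu_u) hu; rewrite lee_fin => cK.
  have sq0 : (0 <= sobolev_sqnorm s (fourier (wp L)))%E.
    rewrite /sobolev_sqnorm mule_ge0//.
      by rewrite lee_fin invr_ge0 exprn_ge0// mulr_ge0// pi_ge0.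
    by apply: integral_ge0 => xi _; rewrite lee_fin mulr_ge0 ?powR_ge0// exprn_ge0// cabs_ge0.
  have nE : ((L ^+ (2 * D)) `^ s' / L ^+ e) = expR (- (g * r)).
    rewrite /L -!expRM_natl -expRN -expRM -expRD; congr expR.
    by rewrite /g natrM; ring.
  have n2 : sobolev_norm s (fourier (wp L)) ^+ 2 <= C * expR (- (g * r)).
    rewrite /sobolev_norm sqr_sqrtr; last exact: fine_ge0.
    rewrite -nE -lee_fin fineK//.
    by rewrite ge0_fin_numE//; apply: le_lt_trans up (ltry _).
  (* Since 0 < c <= K times the norm, squaring is monotone whatever the sign of K. *)
  apply: le_trans (_ : (K * sobolev_norm s (fourier (wp L))) ^+ 2 <= _).
    by rewrite lerXn2r// nnegrE ?(ltW c0)// (le_trans (ltW c0)).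
  by rewrite exprMn ler_wpM2l// sqr_ge0.
(* Chosen so that c^2 g r = K^2 C; then exp(g r) >= 1 + g r contradicts [key], and one value of L
   replaces the limit. *)
pose r := K ^+ 2 * C / (c ^+ 2 * g).
have c20 : 0 < c ^+ 2 by rewrite exprn_gt0.
have r0 : 0 <= r.
  exact: (divr_ge0 (mulr_ge0 (sqr_ge0 K) C0) (ltW (mulr_gt0 c20 g0))).
have := key r r0; rewrite expRN mulrA ler_pdivlMr ?expR_gt0//.
have := expR_ge1Dx (g * r); rewrite -(ler_pM2l c20) => h1 h2.
have := le_trans h1 h2; rewrite mulrDr mulr1 (_ : c ^+ 2 * (g * r) = K ^+ 2 * C).
  by lra.
by rewrite /r; field; rewrite !gt_eqF.
Qed.

End Counterexample.

Theorem theorem1p1 (R : realType) (n k d : nat)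
  (hn : (2 <= n)%N) (hk : (2 <= k)%N) (hd : (2 <= d <= k)%N)
  (P : {mpoly R[n]}) (Q : nat -> {mpoly R[n.-1]})
  (hP : total_degree P k)
  (hQ : forall i : nat, (i <= 1)%N \/ (d <= i <= k)%N ->
    is_form (k - i) (Q (k - i)%N))
  (hlead : homog_part k P = leading_form hn k d Q)
  (hQ1 : Q (k - 1)%N <> 0)
  (s : R)
  (hs : exists Cs : R, maximal_estimate P s Cs) :
  ((forall i : nat, (d <= i <= k)%N -> Q (k - i)%N = 0) -> s_infty R <= s) /\
  (~ (forall i : nat, (d <= i <= k)%N -> Q (k - i)%N = 0) -> s_d R d <= s).
Proof.
have [K hK] := hs; have [v qv] := mpoly_nonroot hQ1.
split=> [Q0|_].
  have := sobolev_exponent_ge (D := 1) (e := 1) hk hP hQ hlead (leqnn 1)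
    (fun i ik => or_introl (Q0 i ik)) qv isT hK.
  by rewrite /s_infty mulr1 mul1r.
have /andP[d2 dk] := hd.
have d0 : (0 < d)%N by exact: leq_trans d2.
have -> : s_d R d = d.-1%:R / (2 * d%:R) by rewrite /s_d -subn1 natrB.
apply: (sobolev_exponent_ge hk hP hQ hlead (leq_pred d) _ qv _ hK).
  move=> i /andP[di ik]; right.
  (* As d <= i, the last summand d may be replaced by i, and (d - 1) i + d (k - i) + i = d k. *)
  apply: (@leq_trans (d.-1 * i + d * (k - i) + i)); first by rewrite leq_add2l.
  by rewrite addnAC -mulSnr prednK// -mulnDr subnKC.
by rewrite -subn1 subn_gt0.
Qed.
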